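(* For every $n\ge1$, the set $\mathcal{M}_n$ of (rooted) simple outerplanar maps with $n+1$ vertices is in one-to-one correspondence with the set $\mathfrak{D}^{\mathbf{s}}_n(1,1)$; in particular $\#\mathcal{M}_n=\#\mathfrak{D}^{\mathbf{s}}_n(1,1)$.
   Context: An outerplanar map is a (connected) planar map all of whose vertices lie on the outer face; it is simple if it has no loops or multiple edges; maps are rooted, with root on the outer face. $s_m$ ($m\ge0$) denotes the little Schröder number: the number of lattice paths from $(0,0)$ to $(m,m)$ with steps $(1,0),(0,1),(1,1)$ staying weakly above $y=x$ and with no $(1,1)$-step on $y=x$ (equivalently the number of dissections of a convex $(m+2)$-gon by nonintersecting diagonals). $\mathfrak{D}^{\mathbf{s}}_n(1,1)$ is the set of colored Dyck paths of semilength $2n$ that are concatenations of down-steps $d$ and blocks $u^{2j}d^{j}$ ($j=1,\dots,n$) — equivalently every maximal ascent has even length $2j$ and is immediately followed by at least $j$ down-steps — where each maximal ascent of length $2j$ is assigned one of $s_{j-1}$ colors. *)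

(* Defs.v *)
From HB Require Import structures.
From mathcomp Require Import all_boot all_fingroup.
From mathcomp Require Import generic_quotient.

Set Implicit Arguments.
Unset Strict Implicit.
Unset Printing Implicit Defensive.

Local Open Scope quotient_scope.

(* Rooted maps are encoded as rotation systems.  A dart is an edge with an    *)
(* orientation; [dart_rev] reverses it and [rot_next] sends it to the next    *)
(* dart counterclockwise around its tail.                                     *)
Record rotation_system := RotationSystem {
  darts : nat;
  rot_next : {perm 'I_darts};
  dart_rev : {perm 'I_darts};
  root : 'I_darts }.

Definition rotation_system_code (M : rotation_system) :
    {d : nat & ({perm 'I_d} * {perm 'I_d} * 'I_d)%type} :=
  Tagged (fun d => ({perm 'I_d} * {perm 'I_d} * 'I_d)%type)
    (rot_next M, dart_rev M, root M).

Definition rotation_system_decode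
    (c : {d : nat & ({perm 'I_d} * {perm 'I_d} * 'I_d)%type}) :=
  RotationSystem (tagged c).1.1 (tagged c).1.2 (tagged c).2.

Lemma rotation_system_codeK :
  cancel rotation_system_code rotation_system_decode.
Proof. by case. Qed.

HB.instance Definition _ :=
  Countable.copy rotation_system (can_type rotation_system_codeK).

Section RotationSystem.
Variable M : rotation_system.

Definition vertex (x : 'I_(darts M)) := porbit (rot_next M) x.

(* On permutations, [s * t] applies [s] first.  The orbit of [x] under        *)
(* [face_next] runs along the boundary of the face to the right of [x].       *)
Definition face_next : {perm 'I_(darts M)} := (dart_rev M * rot_next M)%g.

Definition edge_involution :=
  [forall x, (dart_rev M x != x) && (dart_rev M (dart_rev M x) == x)].

Definition connected_map :=
  [forall x, forall y,
     connect (fun u v => (v == rot_next M u) || (v == dart_rev M u)) x y].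

(* Euler's formula: a connected map lies on the sphere iff V + F = E + 2.     *)
Definition planar_map :=
  #|porbits (rot_next M)| + #|porbits face_next| == #|porbits (dart_rev M)| + 2.

Definition loopless := [forall x, vertex x != vertex (dart_rev M x)].

(* In a loopless map, distinct darts with the same tail and the same head lie *)
(* on distinct parallel edges.                                                *)
Definition no_multiple_edge :=
  [forall x, forall y,
     (vertex x == vertex y) && (vertex (dart_rev M x) == vertex (dart_rev M y))
       ==> (x == y)].

(* The outer face is the one to the right of the root.                        *)
Definition outerplanar :=
  [forall x, exists y, (y \in porbit face_next (root M)) && (y \in vertex x)].

Definition simple_outerplanar (v : nat) :=
  [&& edge_involution, connected_map, planar_map, loopless, no_multiple_edge,
      outerplanar & #|porbits (rot_next M)| == v].

End RotationSystem.

Definition rooted_iso (M N : rotation_system) :=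
  [exists f : {ffun 'I_(darts M) -> 'I_(darts N)},
    [&& injectiveb f, [forall y, y \in codom f], f (root M) == root N,
        [forall x, f (rot_next M x) == rot_next N (f x)]
      & [forall x, f (dart_rev M x) == dart_rev N (f x)]]].

Lemma rooted_isoP (M N : rotation_system) :
  reflect (exists2 f : 'I_(darts M) -> 'I_(darts N), bijective f &
             [/\ f (root M) = root N,
                 forall x, f (rot_next M x) = rot_next N (f x)
               & forall x, f (dart_rev M x) = dart_rev N (f x)])
          (rooted_iso M N).
Proof.
apply: (iffP existsP) => [[f /and5P[/injectiveP fI /forallP fS /eqP f0 /forallP fs
  /forallP fr]] | [f fB [f0 fs fr]]].
  exists f; last by split=> // x; apply/eqP.
  exists (fun y => iinv (fS y)) => [x|y]; last exact: f_iinv.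
  by apply: fI; rewrite f_iinv.
exists (finfun f); have [g fK gK] := fB; apply/and5P; split.
- by apply/injectiveP=> x y; rewrite !ffunE => /(can_inj fK).
- by apply/forallP=> y; apply/codomP; exists (g y); rewrite ffunE gK.
- by rewrite ffunE f0.
- by apply/forallP=> x; rewrite !ffunE fs.
- by apply/forallP=> x; rewrite !ffunE fr.
Qed.

Lemma rooted_iso_refl : reflexive rooted_iso.
Proof. by move=> M; apply/rooted_isoP; exists id => //; exists id. Qed.

Lemma rooted_iso_trans : transitive rooted_iso.
Proof.
move=> N M P /rooted_isoP[f fB [f0 fs fr]] /rooted_isoP[g gB [g0 gs gr]].
apply/rooted_isoP; exists (g \o f); first exact: bij_comp.
by split=> [|x|x] /=; rewrite ?f0 ?fs ?fr.
Qed.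

Lemma rooted_iso_sym : symmetric rooted_iso.
Proof.
suff S M N : rooted_iso M N -> rooted_iso N M by move=> M N; apply/idP/idP; apply: S.
move=> /rooted_isoP[f [g fK gK] [f0 fs fr]]; apply/rooted_isoP.
exists g; first by exists f.
split=> [|x|x]; first by rewrite -f0 fK.
- by rewrite -{1}[x]gK -fs fK.
- by rewrite -{1}[x]gK -fr fK.
Qed.

Definition labelled_outerplanar_map (v : nat) :=
  {M : rotation_system | simple_outerplanar M v}.

Definition outerplanar_iso v : rel (labelled_outerplanar_map v) :=
  fun M N => rooted_iso (val M) (val N).

Definition outerplanar_iso_equiv v : equiv_rel (labelled_outerplanar_map v) :=
  EquivRel (@outerplanar_iso v)
    (fun M => rooted_iso_refl (val M))
    (fun M N => rooted_iso_sym (val M) (val N))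
    (fun N M P => @rooted_iso_trans (val N) (val M) (val P)).

(* The map with one vertex and no edge has no dart, so it is not represented: *)
(* this is the type of rooted simple outerplanar maps with [v] vertices for   *)
(* [v >= 2].                                                                  *)
Definition outerplanar_map (v : nat) := {eq_quot (outerplanar_iso_equiv v)}.

Variant schroder_step := East | North | Diagonal.

Definition schroder_step_code s : option bool :=
  match s with East => Some false | North => Some true | Diagonal => None end.

Definition schroder_step_decode c :=
  match c with Some false => East | Some true => North | None => Diagonal end.

Lemma schroder_step_codeK : cancel schroder_step_code schroder_step_decode.
Proof. by case. Qed.

HB.instance Definition _ :=
  Finite.copy schroder_step (can_type schroder_step_codeK).

(* [schroder_path m x y p]: the path [p] leads from [(x, y)] to [(m, m)],     *)
(* stays weakly above the diagonal, and has no diagonal step on it.           *)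
Fixpoint schroder_path (m x y : nat) (p : seq schroder_step) : bool :=
  match p with
  | [::] => (x == m) && (y == m)
  | East :: p' => (x.+1 <= y) && schroder_path m x.+1 y p'
  | North :: p' => schroder_path m x y.+1 p'
  | Diagonal :: p' => (x < y) && schroder_path m x.+1 y.+1 p'
  end.

(* A path from (0, 0) to (m, m) has at most 2m steps.                         *)
Definition little_schroder (m : nat) : nat :=
  #|[set p : {bseq m.*2 of schroder_step} | schroder_path m 0 0 p]|.

(* In Dyck words, [true] is an up-step and [false] a down-step.               *)
Definition is_dyck (p : seq bool) :=
  (count_mem true p == count_mem false p) &&
  [forall k : 'I_(size p).+1,
     count_mem false (take k p) <= count_mem true (take k p)].

Definition dyck_piece (j : nat) : seq bool :=
  if j == 0 then [:: false] else nseq j.*2 true ++ nseq j false.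

(* Every piece is nonempty, so at most [size p] of them are needed.           *)
Definition is_concatenation_of_pieces (n : nat) (p : seq bool) :=
  [exists w : {bseq size p of 'I_n.+1},
     p == flatten [seq dyck_piece (val j) | j <- w]].

(* The lengths of the maximal ascents, from left to right; [k] counts the     *)
(* up-steps just read.                                                        *)
Fixpoint ascents_from (k : nat) (p : seq bool) : seq nat :=
  match p with
  | [::] => if k == 0 then [::] else [:: k]
  | true :: p' => ascents_from k.+1 p'
  | false :: p' => if k == 0 then ascents_from 0 p' else k :: ascents_from 0 p'
  end.

Definition ascents (p : seq bool) := ascents_from 0 p.

Definition dyck_path (n : nat) :=
  {p : (4 * n).-tuple bool | is_dyck p && is_concatenation_of_pieces n p}.

(* A maximal ascent of length [2j] receives one of [s_(j-1)] colours.         *)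
Definition colouring (p : seq bool) :=
  {dffun forall i : 'I_(size (ascents p)),
     'I_(little_schroder (nth 0 (ascents p) i)./2.-1)}.

Definition coloured_dyck_path (n : nat) :=
  {p : dyck_path n & colouring (val p)}.

(* Main.v *)
(* Walking along the outer face from the root numbers the vertices 0, ..., n   *)
(* in the order of their first visits.  Planarity, in the form of the genus    *)
(* inequality for a pair of permutations, makes the edges noncrossing arcs for *)
(* this numbering and makes each rotation increase cyclically, so the map is   *)
(* given by a noncrossing graph in which every nonzero vertex has a smaller    *)
(* neighbour, and all such graphs occur.  Adding the vertices one at a time,   *)
(* next to a stack of the vertices that are still visible, these graphs are    *)
(* counted by a linear recurrence; coloured Dyck paths, cut into pieces, are   *)
(* counted by another one.  Both recurrences are solved by the series d = 1+e  *)
(* in z (which marks n) such that e = e^2 + z d^2.                             *)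

From HB Require Import structures.
From mathcomp Require Import all_boot all_fingroup ssralg poly polydiv qpoly ssrint.
From mathcomp Require Import generic_quotient zify ring.
Require Import Defs.

Set Implicit Arguments.
Unset Strict Implicit.
Unset Printing Implicit Defensive.

(** * Genus of a pair of permutations *)

(** Both sides are finite of the same size, and the bijection matches two enumerations index by
    index; no direct combinatorial bijection is built.

    From maps to graphs. The outer face meets every vertex, so the root forces a numbering of the
    vertices by first visit ([rank]). For any two permutations the genus is nonnegative
    ([genus_ge0]), which gives a discrete Jordan theorem ([jordan]): in a planar map, an edge
    together with a corner at each of its ends, both on one face, separates the darts into two
    sides. Applied along the outer face, it shows that edges do not cross and that each vertex sees
    its neighbours in cyclic order of their numbers. Hence the graph on the numbers determines the
    map up to rooted isomorphism ([map_adjacent_iso]).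

    From graphs to maps. A canonical graph is drawn with the cyclic rotation. Each upward dart that
    does not start at the largest smaller neighbour of its head is the only upward dart of its face;
    with the outer face this yields enough faces for Euler's formula, and the outer walk meets the
    vertices in order ([canonical_map]).

    Counting. A new vertex of a canonical graph is joined to a nonempty set of visible vertices and
    hides those above the smallest one, which gives [graph_count] ([size_codes]). A coloured Dyck
    path is a word of pieces, which gives [dyck_count] ([card_coloured_dyck_path]). Both recurrences
    are linear with a height parameter and have solutions exponential in the height; uniqueness
    holds because a solution of the homogeneous recurrence is divisible by every power of [z]. The
    colours contribute the Schröder series at [z * d], equal to [1 / (1 - e)], and both counting
    series turn out to be [d = 1 + e] ([graph_dyck_count]). *)

Section Genus.
Variable D : finType.
Implicit Types (s a : {perm D}) (x y z : D) (S : {set D}).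

Definition component s a x : {set D} := orbit 'P <<[set s; a]>>%g x.

Definition components s a : {set {set D}} := [set component s a x | x : D].

Definition ncomponents s a : nat := #|components s a|.

Lemma component_refl s a x : x \in component s a x.
Proof. exact: orbit_refl. Qed.

Lemma component_eqP s a x y :
  reflect (component s a x = component s a y) (x \in component s a y).
Proof. exact: orbit_eqP. Qed.

Lemma component_rot s a x y :
  (s y \in component s a x) = (y \in component s a x).
Proof.
apply: (orbit_actr _ (a := s)); by rewrite mem_gen // !inE eqxx.
Qed.

Lemma component_rev s a x y :
  (a y \in component s a x) = (y \in component s a x).
Proof.
apply: (orbit_actr _ (a := a)); by rewrite mem_gen // !inE eqxx orbT.
Qed.

Lemma component_sub s a S x : x \in S ->
  {in S, forall y, s y \in S} -> {in S, forall y, a y \in S} ->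
  component s a x \subset S.
Proof.
move=> xS sS aS; apply/subsetP => y yx; apply: (acts_in_orbit _ yx xS).
rewrite gen_subG; apply/subsetP => g; rewrite !inE => gP.
by apply/andP; split=> //; apply/subsetP=> z zS; rewrite inE /= apermE;
   case/orP: gP => /eqP->; auto.
Qed.

(** The permutations [a] and [tperm x y * a] agree outside [x] and [y], so a new component avoiding
    both points is closed under [a]. *)
Lemma component_split s a x y z :
  (component s a z \subset component s (tperm x y * a)%g z) ||
  (z \in component s (tperm x y * a)%g x :|: component s (tperm x y * a)%g y).
Proof.
set a' := (_ * a)%g; set S := component s a' z.
have [|zxy] := boolP (z \in _ :|: _); first by rewrite orbT.
rewrite orbF; apply: component_sub; rewrite ?component_refl //.
- by move=> u uS; rewrite component_rot.
- move=> u uS; have ux : u != x.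
    apply: contraNneq zxy => ux; rewrite inE -ux.
    by move/component_eqP: uS => ->; rewrite component_refl.
  have uy : u != y.
    apply: contraNneq zxy => uy; rewrite inE -uy orbC.
    by move/component_eqP: uS => ->; rewrite component_refl.
  have -> : a u = a' u by rewrite permM tpermD // eq_sym.
  by rewrite component_rev.
Qed.

(** Discarding the new component of [y], the map that sends a new component to the old component of
    one of its points is injective: by [component_split], at most one of the remaining ones fails to
    contain the old component. *)
Lemma card_components_split s a x y :
  ncomponents s (tperm x y * a)%g <= (ncomponents s a).+1.
Proof.
set a' := (_ * a)%g; rewrite /ncomponents (cardsD1 (component s a' y)).
rewrite -add1n leq_add ?leq_b1 //.
pose f (A : {set D}) := if [pick z in A] is Some z then component s a z else A.
have fE A : A \in components s a' :\ component s a' y ->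
   exists2 z, A = component s a' z & f A = component s a z /\ z \notin component s a' y.
  rewrite !inE => /andP[Ay /imsetP[u _ Au]]; rewrite /f.
  case: pickP => [z|/(_ u)]; last by rewrite Au component_refl.
  rewrite Au => /component_eqP zu; exists z => //; split=> //.
  by apply: contra Ay => /component_eqP <-; rewrite Au zu.
rewrite -(card_in_imset (f := f)); last first.
  move=> A B /fE[u Au [-> uy]] /fE[v Bv [-> vy]] uv.
  have := component_split s a x y u; have := component_split s a x y v.
  rewrite -/a' !inE (negPf uy) (negPf vy) !orbF.
  case/orP=> [/subsetP/(_ u)|vx]; first by rewrite -uv component_refl Au Bv => /(_ isT)/component_eqP.
  case/orP=> [/subsetP/(_ v)|ux]; first by rewrite uv component_refl Au Bv => /(_ isT)/component_eqP.
  by rewrite Au Bv; move/component_eqP: vx => ->; move/component_eqP: ux => ->.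
apply/subset_leq_card/subsetP => C /imsetP[A /fE[z _ [-> _]] ->].
exact: imset_f.
Qed.

(** When [x] and [y] stay together, new components are closed under [a] as well, hence are unions of
    old ones. *)
Lemma components_same s a x y :
  y \in component s (tperm x y * a)%g x ->
  ncomponents s (tperm x y * a)%g <= ncomponents s a.
Proof.
set a' := (_ * a)%g => yx.
have sub z : component s a z \subset component s a' z.
  have [zxy|zxy] := boolP (z \in component s a' x); last first.
    have := component_split s a x y z; rewrite -/a' !inE (negPf zxy) /=.
    by move/component_eqP: yx => ->; rewrite (negPf zxy) orbF.
  move/component_eqP: (zxy) => ->.
  apply: component_sub => // u ux; first by rewrite component_rot.
  have -> : a u = a' (tperm x y u) by rewrite permM tpermK.
  rewrite component_rev; case: tpermP => // _.
  exact: component_refl.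
have eA : components s a' = [set \bigcup_(z in A) component s a' z | A : {set D} in components s a].
  apply/setP=> A; apply/imsetP/imsetP => [[z _ ->]|[_ /imsetP[z _ ->] ->]].
    exists (component s a z); first exact: imset_f.
    apply/setP=> u; apply/idP/bigcupP => [uz|[v vz uv]].
      by exists z; rewrite ?component_refl.
    by have /component_eqP <- := subsetP (sub z) v vz.
  exists z => //; apply/setP=> u; apply/bigcupP/idP => [[v vz uv]|uz].
    by have /component_eqP <- := subsetP (sub z) v vz.
  by exists z; rewrite ?component_refl.
rewrite /ncomponents eA; exact: leq_imset_card.
Qed.

Lemma porbits1 : #|porbits (1 : {perm D})| = #|D|.
Proof.
rewrite /porbits card_imset // => x y /eqP; rewrite eq_porbit_mem => /porbitP[i ->].
by rewrite expg1n perm1.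
Qed.

Lemma porbit_sub_component s a x : porbit s x \subset component s a x.
Proof.
apply/subsetP=> y /porbitP[i ->]; elim: i => [|i IH]; first by rewrite expg0 perm1 component_refl.
by rewrite expgSr permM component_rot.
Qed.

Lemma porbit_mul_sub_component s a x : porbit (a * s)%g x \subset component s a x.
Proof.
apply/subsetP=> y /porbitP[i ->]; elim: i => [|i IH]; first by rewrite expg0 perm1 component_refl.
by rewrite expgSr !permM component_rot component_rev.
Qed.

(* Fixing one point at a time in [a] changes the two sides in a controlled    *)
(* way, down to [a = 1].                                                      *)
Lemma genus_ge0 s a :
  #|porbits s| + #|porbits a| + #|porbits (a * s)| <= #|D| + (ncomponents s a).*2.
Proof.
have [n] := ubnP #|[set x | a x != x]|; elim: n a => // n IH a an.
have [a1|[x]] := set_0Vmem [set x | a x != x]; last first.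
  rewrite inE => ax; set t := tperm x (a x); set a' := (t * a)%g.
  have a'ax : a' (a x) = a x by rewrite permM tpermR.
  have /IH : #|[set x | a' x != x]| < n.
    rewrite -ltnS; apply: leq_trans an; rewrite ltnS; apply: proper_card.
    apply/properP; split; last first.
      by exists (a x); rewrite inE ?a'ax ?eqxx // (inj_eq perm_inj).
    apply/subsetP=> u; rewrite !inE; apply: contraNneq => au.
    rewrite permM tpermD ?au //; apply: contraNneq ax => ux; first by rewrite ux au.
    by apply/eqP/(@perm_inj _ a); rewrite ux.
  have := porbits_mul_tperm a x (a x).
  have := porbits_mul_tperm (a * s)%g x (a x).
  have taE : (t * (a * s) = a' * s)%g by rewrite mulgA.
  have taE' : (t * (a' * s) = a * s)%g by apply/permP=> u; rewrite !permM tpermK.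
  rewrite /= -/t -/a' taE (eq_sym x) ax (porbit_sym a).
  rewrite -(porbit_perm a 1 x) expg1 porbit_id /=.
  have := card_components_split s a x (a x); rewrite -/t -/a'.
  case: (boolP (x \in porbit (a * s)%g (a x))) => xax /=; first by lia.
  have := porbits_mul_tperm (a' * s)%g x (a x).
  rewrite /= -/t taE' (eq_sym x) ax.
  case: (boolP (x \in porbit (a' * s)%g (a x))) => [xa'|]; last by lia.
  (* An orbit of [a * s] is lost only when [x] and [a x] end up in one orbit of [a' * s]; they then
     share a component, so the number of components does not grow. *)
  have := components_same (s := s) (a := a) (x := x) (y := a x); rewrite -/t -/a'.
  rewrite orbit_sym (subsetP (porbit_mul_sub_component _ _ _) _ xa').
  by move=> /(_ isT); lia.
have {a1 IH an} -> : a = 1%g.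
  apply/permP => x; rewrite perm1; apply/eqP; apply: contraT => ax.
  by move/setP/(_ x): a1; rewrite !inE ax.
rewrite mul1g porbits1.
suff -> : ncomponents s 1%g = #|porbits s| by lia.
rewrite /ncomponents /components /porbits; congr #|pred_of_set _|; apply: eq_imset => x.
apply/eqP; rewrite eqEsubset porbit_sub_component andbT.
apply: component_sub; first exact: porbit_id.
- move=> y; rewrite !(porbit_sym s _ x) -!eq_porbit_mem => /eqP ->.
  by rewrite (porbit_perm s 1).
- by move=> y; rewrite perm1.
Qed.
End Genus.

(** * A discrete Jordan curve theorem *)

(** Stepping by [a * s] follows the face to the right of [r]; [find] returns the length of that face
    if it misses the vertex of [x]. *)
Definition first_visit (D : finType) (s a : {perm D}) (r x : D) : nat :=
  find (mem (porbit s x)) (traject (a * s)%g r #|porbit (a * s)%g r|).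

Definition rank (D : finType) (s a : {perm D}) (r x : D) : nat :=
  #|[set porbit s y | y : D & first_visit s a r y < first_visit s a r x]|.

Definition adjacent (D : finType) (s a : {perm D}) (r : D) (i j : nat) : bool :=
  [exists x, (rank s a r x == i) && (rank s a r (a x) == j)].

(* A graph on the vertices [0, ..., n], of which only the edges [e i j] with  *)
(* [i < j] are looked at.                                                     *)
Definition canonical (n : nat) (e : rel nat) : Prop :=
  (forall j, 0 < j <= n -> exists2 i, i < j & e i j) /\
  (forall i k j l, i < k < j -> j < l <= n -> e i j -> ~~ e k l).

Section Jordan.
Variables (D : finType) (s a : {perm D}).
Local Notation phi := (a * s)%g.
Hypothesis aK : involutive a.
Hypothesis a_neq : forall x, a x != x.
Hypothesis connected : forall (S : {set D}) x, x \in S ->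
  {in S, forall y, s y \in S} -> {in S, forall y, a y \in S} -> S = setT.
Hypothesis euler : #|porbits s| + #|porbits phi| = #|porbits a| + 2.
Hypothesis loopless_s : forall x, a x \notin porbit s x.

Lemma card_porbits_involution : #|porbits a|.*2 = #|D|.
Proof.
have := card_uniform_partition (n := 2) (P := porbits a) (D := [set: D]).
rewrite cardsT => ->; first by rewrite muln2.
- move=> A /imsetP[x _ ->].
  have -> : porbit a x = [set x; a x].
    apply/setP=> y; rewrite !inE; apply/porbitP/orP => [[i ->]|].
      elim: i => [|i]; first by rewrite expg0 perm1 eqxx; left.
      by rewrite expgSr permM => -[] /eqP ->; [right|left; rewrite aK].
    by case=> /eqP ->; [exists 0; rewrite perm1|exists 1; rewrite expg1].
  by rewrite cards2 eq_sym a_neq.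
- apply/and3P; split.
  + rewrite eqEsubset subsetT; apply/subsetP=> x _.
    by apply/bigcupP; exists (porbit a x); rewrite ?porbit_id ?imset_f.
  + apply/trivIsetP=> _ _ /imsetP[x _ ->] /imsetP[y _ ->].
    apply: contraR => /pred0Pn[z /= /andP[]].
    by rewrite !(porbit_sym a z) -!eq_porbit_mem => /eqP-> /eqP->.
  + by apply/imsetP=> -[x _ x0]; have := porbit_id a x; rewrite -x0 inE.
Qed.

Lemma card_porbits_mulr_tperm (b : {perm D}) (x y : D) : x != y -> y \in porbit b x ->
  #|porbits (b * tperm x y)%g| = #|porbits b|.+1.
Proof.
move=> xy yx; have /= := porbits_mul_tperm b^-1%g x y.
have -> : (tperm x y * b^-1 = (b * tperm x y)^-1)%g by rewrite invMg tpermV.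
by rewrite /= !porbitsV porbitV xy (porbit_sym b) yx /= !addn0 addn1.
Qed.

(* Contracting the edge of [x] keeps the faces, and then splitting the merged *)
(* vertex at two of its corners [p], [q] on one face raises Euler's sum by 2: *)
(* by [genus_ge0] this disconnects the map, and [K] is one of the two sides.  *)
Lemma jordan x p q :
    p \in porbit s x -> q \in porbit s (a x) -> q \in porbit phi p ->
  exists K : {set D},
    [/\ p \in K, q \notin K,
        forall y, y != x -> y != a x -> (a y \in K) = (y \in K),
        forall y, y != x -> y != a x -> s y != p -> s y != q ->
          (s y \in K) = (y \in K)
      & forall y, phi y != p -> phi y != q -> (phi y \in K) = (y \in K)].
Proof.
move=> px qx qp.
pose t := tperm x (a x); pose u := tperm p q.
pose a1 := (t * a)%g; pose s1 := (t * s)%g; pose s2 := (s1 * u)%g.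
have xax : x \notin porbit s (a x) by rewrite porbit_sym loopless_s.
have pq : p != q.
  apply: contraNneq xax => pq; rewrite -eq_porbit_mem.
  by move: px qx; rewrite -pq -!eq_porbit_mem => /eqP<- /eqP<-.
have taE y : t (a (t y)) = a y.
  rewrite /t; case: (tpermP x (a x) y) => [->|->|/eqP yx /eqP yax].
  - by rewrite aK tpermL.
  - by rewrite tpermR aK.
  - by rewrite tpermD // ?(inj_eq perm_inj) 1?eq_sym // (canF_eq aK).
have phi1 : (a1 * s1 = phi)%g by apply/permP=> y; rewrite !permM taE.
have phi2 : (a1 * s2 = phi * u)%g by rewrite mulgA phi1.
have za : #|porbits a1| = #|porbits a|.+1.
  have /= := porbits_mul_tperm a x (a x); rewrite /= -/t -/a1 eq_sym a_neq.
  by rewrite porbit_sym (mem_porbit a 1) /= addn0 addn1.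
have zs : #|porbits s| = #|porbits s1|.+1.
  have /= := porbits_mul_tperm s x (a x); rewrite /= -/t -/s1 eq_sym a_neq xax /=; lia.
have s1x : x \in porbit s1 (a x).
  have /= := porbits_mul_tperm s1 x (a x).
  have -> : (tperm x (a x) * s1 = s)%g by apply/permP=> y; rewrite !permM tpermK.
  by rewrite /= zs (eq_sym x) a_neq /=; case: (_ \in _) => //=; lia.
have s1s y : porbit s y \subset porbit s1 y.
  apply/subsetP=> z /porbitP[i ->]; elim: i => [|i IH]; first by rewrite perm1 porbit_id.
  rewrite expgSr permM; set w := (s ^+ i)%g y in IH *.
  have -> : s w = s1 (t w) by rewrite permM tpermK.
  have wt : porbit s1 (t w) = porbit s1 w.
    by rewrite /t; case: tpermP => [->|->|//]; apply/eqP;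
       rewrite eq_porbit_mem // porbit_sym.
  move: IH; rewrite -!eq_porbit_mem => /eqP<-; rewrite -wt.
  by rewrite -(porbit_perm s1 1 (t w)).
have s1p : porbit s1 p = porbit s1 x by apply/eqP; rewrite eq_porbit_mem (subsetP (s1s x)).
have s1q : porbit s1 q = porbit s1 x.
  apply/eqP; rewrite eq_porbit_mem.
  by move: s1x; rewrite -eq_porbit_mem => /eqP ->; rewrite (subsetP (s1s _)).
have zs2 : #|porbits s2| = #|porbits s1|.+1.
  by rewrite card_porbits_mulr_tperm // -eq_porbit_mem s1p s1q.
have zp2 : #|porbits (a1 * s2)%g| = #|porbits phi|.+1.
  by rewrite phi2 card_porbits_mulr_tperm.
pose K := component s2 a1 p.
have Ks y : (s2 y \in K) = (y \in K) by apply: component_rot.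
have Ka y : (a1 y \in K) = (y \in K) by apply: component_rev.
have pK : p \in K by apply: component_refl.
have qK : q \notin K.
  apply/negP => qK.
  have uK y : (u y \in K) = (y \in K) by rewrite /u; case: tpermP => [->|->|]; rewrite ?pK ?qK.
  have s1K y : (s1 y \in K) = (y \in K) by rewrite -(Ks y) [s2 y]permM uK.
  have s1oK z y : z \in porbit s1 y -> (z \in K) = (y \in K).
    by case/porbitP=> i ->; elim: i => [|i IH]; rewrite ?perm1 // expgSr permM s1K.
  have xK : x \in K by rewrite -(s1oK p x) // -s1p porbit_id.
  have axK : a x \in K by rewrite -(s1oK x (a x)).
  have tK y : (t y \in K) = (y \in K) by rewrite /t; case: tpermP => [->|->|]; rewrite ?xK ?axK.
  have sE y : s y = s1 (t y) by rewrite permM tpermK.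
  have aE y : a y = a1 (t y) by rewrite permM tpermK.
  have KT : K = setT.
    by apply: (connected pK) => y yK; rewrite ?sE ?aE ?s1K ?Ka tK.
  have c1 : ncomponents s2 a1 <= 1.
    rewrite -(cards1 K) /ncomponents subset_leq_card //.
    apply/subsetP=> _ /imsetP[y _ ->]; rewrite inE; apply/eqP/component_eqP.
    by rewrite -/K KT inE.
  (* The three orbit numbers now add up to [#|D| + 4], whereas a single component allows at most
     [#|D| + 2]. *)
  have := genus_ge0 s2 a1; have := card_porbits_involution.
  by rewrite zp2 zs2 za; lia.
exists K; split=> // [y yx yax|y yx yax sp sq|y fp fq].
- by rewrite -[in RHS]Ka permM tpermD // eq_sym.
- by rewrite -[in RHS]Ks !permM [t y]tpermD 1?eq_sym // tpermD // eq_sym.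
- have -> : phi y = (a1 * s2)%g y by rewrite phi2 [RHS]permM tpermD // eq_sym.
  by rewrite permM Ks Ka.
Qed.

Definition between (i j k : nat) : bool := [|| i < j < k, j < k < i | k < i < j].

(** Read cyclically, [b] can change only on entering [P] or [Q], so it is constant on the two arcs
    that these cut out. *)
Lemma between_arc (L P Q : nat) (b : nat -> bool) :
    P < L -> Q < L -> b P -> ~~ b Q ->
    (forall i, i.+1 < L -> i.+1 != P -> i.+1 != Q -> b i.+1 = b i) ->
    (0 != P -> 0 != Q -> b 0 = b L.-1) ->
  forall i, i < L -> i != P -> i != Q -> b i = between P i Q.
Proof.
move=> PL QL bP bQ bS b0.
have run i j : i <= j -> j < L -> ~~ (i < P <= j) -> ~~ (i < Q <= j) -> b j = b i.
  elim: j => [|j IH] ij jL jP jQ; first by have -> : i = 0 by lia.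
  have [->//|ij'] := eqVneq i j.+1.
  by rewrite bS ?IH //; lia.
move=> i iL iP iQ; rewrite /between.
have [PQ|QP] : P < Q \/ Q < P by move: bP bQ; case: (ltngtP P Q) => [||-> ->]; auto.
- have [Pi|iP'] := leqP P i.
    by have [Qi|iQ'] := leqP Q i; [rewrite (run Q i) ?(negPf bQ)|rewrite (run P i) ?bP]; lia.
  by rewrite (run 0 i) ?b0 ?(run Q L.-1) ?(negPf bQ); lia.
- have [Qi|iQ'] := leqP Q i.
    by have [Pi|iP'] := leqP P i; [rewrite (run P i) ?bP|rewrite (run Q i) ?(negPf bQ)]; lia.
  by rewrite (run 0 i) ?b0 ?(run P L.-1) ?bP; lia.
Qed.

(** * The order of the vertices along the outer face *)

Section OuterWalk.
Hypothesis simple_s : forall x y, y \in porbit s x -> a y \in porbit s (a x) -> x = y.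
Variable r : D.
Hypothesis outer : forall x, exists2 y, y \in porbit phi r & y \in porbit s x.

Let L := #|porbit phi r|.
Let w i := iter i phi r.

Lemma walk_inj i j : i < L -> j < L -> w i = w j -> i = j.
Proof.
move=> iL jL wij; apply/eqP.
rewrite -(nth_uniq r _ _ (uniq_traject_porbit phi r)) ?size_traject //.
by rewrite !nth_traject //; apply/eqP.
Qed.

Lemma walk_last : phi (w L.-1) = r.
Proof.
have L0 : 0 < L by rewrite lt0n card_porbit_neq0.
have -> : phi (w L.-1) = iter L.-1.+1 phi r by [].
by rewrite prednK // iter_porbit.
Qed.

Lemma first_visitP x : [/\ first_visit s a r x < L,
   w (first_visit s a r x) \in porbit s x &
   forall i, i < L -> w i \in porbit s x -> first_visit s a r x <= i].
Proof.
rewrite /first_visit; set W := traject phi r _.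
have hasW : has (mem (porbit s x)) W.
  by have [y yr yx] := outer x; apply/hasP; exists y => //; rewrite -porbit_traject.
have fL : find (mem (porbit s x)) W < L by rewrite -(size_traject phi r L) -has_find.
split=> // [|i iL wi].
  by have := nth_find r hasW; rewrite nth_traject.
rewrite leqNgt; apply/negP => /(before_find r); rewrite nth_traject //= => /negP; exact.
Qed.

Local Notation ft := (first_visit s a r).

Lemma first_visit_eq x y : (ft x == ft y) = (y \in porbit s x).
Proof.
apply/eqP/idP => [e|]; last by rewrite /first_visit -eq_porbit_mem eq_sym => /eqP->.
have [_ wx _] := first_visitP x; have [_ wy _] := first_visitP y.
by move: wx wy; rewrite e -!eq_porbit_mem => /eqP<- /eqP<-.
Qed.

(** This is the cut of [jordan] along the edge of [x], at the corners where the outer walk first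
    meets its two ends. The walk changes sides only there, so the side of any other vertex can be
    read off its first visit. *)
Lemma first_visit_side x : exists K : {set D},
  [/\ forall y, y != x -> y != a x -> (a y \in K) = (y \in K),
      forall z, ft z != ft x -> ft z != ft (a x) ->
        (z \in K) = between (ft x) (ft z) (ft (a x))
    & forall i, (forall k, k < i -> iter k s (w (ft x)) != x) ->
        iter i s (w (ft x)) \in K].
Proof.
have [xL wx _] := first_visitP x; have [axL wax _] := first_visitP (a x).
have wr i : w i \in porbit phi r by rewrite /w -permX mem_porbit.
have wpw : w (ft (a x)) \in porbit phi (w (ft x)).
  by have := wr (ft x); rewrite -eq_porbit_mem => /eqP ->; exact: wr.
have [K [pK qK Ka Ks Kphi]] := jordan wx wax wpw.
have vertex_neq y z : ft y != ft z -> y != z by apply: contraNneq => ->.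
have ftE y z : z \in porbit s y -> ft z = ft y.
  by rewrite -first_visit_eq => /eqP.
have ftw y : ft (w (ft y)) = ft y by apply: ftE; have [] := first_visitP y.
have xax : ft x != ft (a x) by rewrite first_visit_eq loopless_s.
have fts y : ft (s y) = ft y by apply: ftE; exact: (mem_porbit s 1).
have Kw i : i < L -> i != ft x -> i != ft (a x) ->
    (w i \in K) = between (ft x) i (ft (a x)).
  apply: (between_arc (b := fun i => w i \in K)) => // [{}i iL ip iq|p0 q0].
    have -> : w i.+1 = phi (w i) by [].
    by apply: Kphi; [move: ip|move: iq]; apply: contraNneq => /(walk_inj iL) ->.
  have -> : w 0 = phi (w L.-1) by rewrite walk_last.
  have L0 : 0 < L by exact: leq_ltn_trans xL.
  by apply: Kphi; rewrite walk_last; [move: p0|move: q0];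
     apply: contraNneq => /(@walk_inj 0 _ L0) ->.
exists K; split=> // [z zx zax|i].
  have [zL wz _] := first_visitP z.
  rewrite -Kw //; have /porbitP[i ze] : z \in porbit s (w (ft z)) by rewrite porbit_sym.
  rewrite [in LHS]ze {ze}; elim: i => [|i IH]; first by rewrite perm1.
  rewrite expgSr permM; set y := (s ^+ i)%g _ in IH *.
  have ftz : ft y = ft z by rewrite -[RHS]ftw; apply: ftE; exact: mem_porbit.
  by rewrite Ks // vertex_neq ?fts ?ftw ?ftz.
elim: i => [|i IH] ix; first exact: pK.
have iK := IH (fun k ki => ix k (ltnW ki)).
have fti : ft (iter i s (w (ft x))) = ft x by elim: {IH ix iK} i => [|i IH]; rewrite ?iterS ?fts ?ftw.
rewrite iterS; have [->//|sp] := eqVneq (s (iter i s (w (ft x)))) (w (ft x)).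
by rewrite Ks ?ix // vertex_neq // ?fts fti ?ftw.
Qed.

Lemma first_visit_rot x : ft (s x) = ft x.
Proof. by apply/eqP; rewrite eq_sym first_visit_eq (mem_porbit s 1). Qed.

Lemma first_visit_iter i x : ft (iter i s x) = ft x.
Proof. by elim: i => //= i IH; rewrite first_visit_rot. Qed.

Lemma first_visit_loop x : ft (a x) != ft x.
Proof. by rewrite eq_sym first_visit_eq loopless_s. Qed.

Lemma first_visit_simple x y : ft x = ft y -> ft (a x) = ft (a y) -> x = y.
Proof.
by move/eqP; rewrite first_visit_eq => xy /eqP; rewrite first_visit_eq; apply: simple_s.
Qed.

Lemma first_visit_walk x : ft (w (ft x)) = ft x.
Proof. by apply/eqP; rewrite eq_sym first_visit_eq; have [] := first_visitP x. Qed.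

(** In the cut along the later dart, the earlier dart lies in [K], hence so does its reverse; as the
    map is simple, the head of the earlier dart is not an end of the cut edge, and its position is
    the one claimed. *)
Lemma rotation_order x i j : i < j -> j < #|porbit s x| ->
  between (ft x) (ft (a (iter i s (w (ft x))))) (ft (a (iter j s (w (ft x))))).
Proof.
move=> ij jn; set p := w (ft x); set y := iter i s p; set z := iter j s p.
have [xL px _] := first_visitP x.
have fty : ft y = ft x by rewrite first_visit_iter first_visit_walk.
have ftz : ft z = ft x by rewrite first_visit_iter first_visit_walk.
have neq k l : k < l -> l < #|porbit s x| -> iter k s p != iter l s p.
  move=> kl ln; have kn := ltn_trans kl ln.
  move: px kn ln; rewrite -/p -eq_porbit_mem => /eqP <- kn ln.
  rewrite -(nth_traject s kn) -(nth_traject s ln).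
  by rewrite nth_uniq ?size_traject ?uniq_traject_porbit // neq_ltn kl.
have yz : y != z by apply: neq.
have yaz : y != a z.
  by apply: contraNneq (first_visit_loop z) => <-; rewrite fty ftz.
have [K [Ka Kz Ki]] := first_visit_side z.
have yK : y \in K.
  rewrite /y /p -ftz; apply: Ki => k ki; rewrite ftz; apply: neq => //.
  exact: ltn_trans ki ij.
rewrite -ftz -Kz ?Ka //; first by rewrite ftz -fty first_visit_loop.
by apply: contra yz => /eqP e; apply/eqP/first_visit_simple; rewrite ?fty ?ftz.
Qed.

Lemma rotation_between x z : z \in porbit s x -> z != x -> z != s x ->
  between (ft (a x)) (ft (a (s x))) (ft (a z)).
Proof.
move=> zx; pose p := w (ft x); pose n := #|porbit s x|.
have [xL px _] := first_visitP x.
have np : #|porbit s p| = n by move: px; rewrite -eq_porbit_mem => /eqP ->.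
have xp : x \in porbit s p by rewrite porbit_sym.
have zp : z \in porbit s p by move: px zx; rewrite -!eq_porbit_mem => /eqP->.
move: (xp) (zp); rewrite !porbit_traject !np => /trajectP[i iN xE] /trajectP[j jN zE].
have O k l : k < l -> l < n ->
  between (ft x) (ft (a (iter k s p))) (ft (a (iter l s p))) := @rotation_order x k l.
rewrite zE {1 2 3 4}xE => zx' zsx.
have [ij|ji|ij] := ltngtP i j; last by rewrite ij eqxx in zx'.
- have iSj : i.+1 < j by rewrite ltn_neqAle ij andbT; apply: contraNneq zsx => <-.
  have := O i i.+1 (ltnSn i) (ltn_trans iSj jN).
  have := O _ _ iSj jN; have := O _ _ ij jN.
  by rewrite /between /=; lia.
- have [iSn|iSn] := ltnP i.+1 n.
    have := O i i.+1 (ltnSn i) iSn; have := O _ _ ji iN.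
    have := O j i.+1 (ltn_trans ji (ltnSn i)) iSn.
    by rewrite /between /=; lia.
  (* Here [x] is the last dart of the turn around its vertex, so [s x] is the first one. *)
  have iE : i.+1 = n by lia.
  have sE : s (iter i s p) = iter 0 s p by rewrite -iterS iE -np iter_porbit.
  have j0 : 0 < j by rewrite lt0n; apply: contraNneq zsx => ->; rewrite sE.
  rewrite sE; have := O _ _ j0 jN; have := O _ _ ji iN.
  have := O _ _ (ltn_trans j0 ji) iN.
  by rewrite /between /=; lia.
Qed.

(** An edge sharing no end with that of [x] has both darts on the same side of the cut along [x]. *)
Lemma first_visit_noncrossing x y :
  ~~ [&& ft x < ft y, ft y < ft (a x) & ft (a x) < ft (a y)].
Proof.
apply/and3P => -[xy yax xay].
have [K [Ka Kz _]] := first_visit_side x.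
have neq u v : ft u != ft v -> u != v by apply: contraNneq => ->.
have := Ka y; rewrite (Kz y) ?(Kz (a y)) ?neq //; rewrite /between; lia.
Qed.

(** The dart along which the walk first arrives at a vertex starts at a vertex met earlier. *)
Lemma first_visit_parent x : ft x != 0 -> exists2 y, y \in porbit s x & ft (a y) < ft x.
Proof.
have [xL px _] := first_visitP x; case ftx : (ft x) xL px => [//|k] kL px _.
have kL' := ltnW kL.
exists (a (w k)); first by move: px; rewrite /w iterS permM -/(w k) -!eq_porbit_mem (porbit_perm s 1).
by rewrite aK ltnS; have [_ _ ->] := first_visitP (w k); rewrite ?porbit_id.
Qed.

Lemma first_visit_root : ft r = 0.
Proof.
have [rL _ /(_ 0)] := first_visitP r; rewrite porbit_id leqn0.
by move=> /(_ (leq_ltn_trans (leq0n _) rL) isT)/eqP.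
Qed.

Lemma first_visit_root_rev : ft (a r) = 1.
Proof.
have ar0 : ft (a r) != 0 by rewrite -first_visit_root first_visit_loop.
have [arL _ /(_ 1)] := first_visitP (a r).
have -> : w 1 = s (a r) by rewrite /w /= permM.
by rewrite (mem_porbit s 1); move: arL ar0 => /=; clear euler; lia.
Qed.

Local Notation rk := (rank s a r).

Lemma rank_lt x y : (rk x < rk y) = (ft x < ft y).
Proof.
have sub u v : ft u <= ft v -> rk u <= rk v.
  move=> uv; apply: subset_leq_card; apply/subsetP=> A /imsetP[z]; rewrite inE => zu ->.
  by apply: imset_f; rewrite inE (leq_trans zu).
apply/idP/idP => [|xy]; first by apply: contraTT; rewrite -!leqNgt; apply: sub.
apply: proper_card; apply/properP; split.
  apply/subsetP=> A /imsetP[z]; rewrite inE => zu ->.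
  by apply: imset_f; rewrite inE (ltn_trans zu).
exists (porbit s x); first by apply: imset_f; rewrite inE.
apply/negP => /imsetP[z]; rewrite inE => zx /eqP.
by rewrite eq_porbit_mem -first_visit_eq ltn_eqF.
Qed.

Lemma rank_eq x y : (rk x == rk y) = (y \in porbit s x).
Proof. by rewrite -first_visit_eq; move: (rank_lt x y) (rank_lt y x); clear; lia. Qed.

Lemma rank_between x y z : between (rk x) (rk y) (rk z) = between (ft x) (ft y) (ft z).
Proof. by rewrite /between !rank_lt. Qed.

Lemma rank_bound x : rk x < #|porbits s|.
Proof.
apply: proper_card; apply/properP; split.
  by apply/subsetP=> _ /imsetP[z _ ->]; apply: imset_f.
exists (porbit s x); first exact: imset_f.
apply/negP => /imsetP[z]; rewrite inE => zx /eqP.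
by rewrite eq_porbit_mem -first_visit_eq ltn_eqF.
Qed.

Lemma rank_surj i : i < #|porbits s| -> exists x, rk x = i.
Proof.
move=> iV; pose g (A : {set D}) : 'I_#|porbits s| :=
  if [pick x in A] is Some x then Ordinal (rank_bound x) else Ordinal iV.
have gE x : g (porbit s x) = rk x :> nat.
  rewrite /g; case: pickP => [y yx|/(_ x)]; last by rewrite porbit_id.
  by apply/eqP; rewrite eq_sym rank_eq.
have gT : g @: porbits s = [set: _].
  apply/eqP; rewrite eqEcard subsetT cardsT card_ord card_in_imset ?leqnn //.
  move=> _ _ /imsetP[x _ ->] /imsetP[y _ ->] gxy.
  move: (congr1 val gxy); rewrite /= !gE => /eqP; rewrite rank_eq porbit_sym -eq_porbit_mem => /eqP; exact.
have : Ordinal iV \in g @: porbits s by rewrite gT inE.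
by case/imsetP => _ /imsetP[x _ ->] gx; exists x; rewrite -gE -gx.
Qed.

Lemma rank_rot x : rk (s x) = rk x.
Proof. by apply/eqP; rewrite eq_sym rank_eq (mem_porbit s 1). Qed.

Lemma rank_simple x y : rk x = rk y -> rk (a x) = rk (a y) -> x = y.
Proof. by move=> /eqP + /eqP; rewrite !rank_eq; apply: simple_s. Qed.

Lemma rank_root : rk r = 0.
Proof.
apply/eqP; rewrite cards_eq0; apply/eqP/setP => A; rewrite in_set0.
by apply/imsetP => -[y]; rewrite inE first_visit_root ltn0.
Qed.

Lemma adjacent_sym : symmetric (adjacent s a r).
Proof.
suff S i j : adjacent s a r i j -> adjacent s a r j i by move=> i j; apply/idP/idP; apply: S.
by case/existsP=> x /andP[xi xj]; apply/existsP; exists (a x); rewrite aK xi xj.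
Qed.

Lemma adjacent_irrefl i : adjacent s a r i i = false.
Proof.
apply/existsP=> -[x /andP[/eqP <-]].
by rewrite eq_sym rank_eq (negPf (loopless_s x)).
Qed.

Lemma adjacent_bound i j : adjacent s a r i j -> (i < #|porbits s|) && (j < #|porbits s|).
Proof. by case/existsP => x /andP[/eqP<- /eqP<-]; rewrite !rank_bound. Qed.

Lemma adjacent_canonical n : #|porbits s| = n.+1 -> canonical n (adjacent s a r).
Proof.
move=> V; split=> [j /andP[j0 jn]|i k j l /andP[ik kj] /andP[jl ln]].
- have [|x xj] := @rank_surj j; first by rewrite V.
  have /first_visit_parent[y yx ayx] : ft x != 0.
    by rewrite -lt0n -first_visit_root -rank_lt xj rank_root.
  exists (rk (a y)); first by rewrite -xj rank_lt.
  apply/existsP; exists (a y); rewrite eqxx aK -xj eq_sym rank_eq //.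
- case/existsP=> x /andP[/eqP xi /eqP xj]; apply/existsP => -[y /andP[/eqP yk /eqP yl]].
  have := first_visit_noncrossing x y.
  by rewrite -!rank_lt xi xj yk yl ik kj jl.
Qed.

Lemma rank_root_rev : rk (a r) = 1.
Proof.
have -> : rk (a r) = #|[set porbit s r]|; last by rewrite cards1.
apply: eq_card => A; rewrite inE; apply/imsetP/eqP => [[y]|->].
  rewrite inE first_visit_root_rev ltnS leqn0 -first_visit_root first_visit_eq => ry ->.
  by apply/eqP; rewrite eq_porbit_mem porbit_sym.
by exists r => //; rewrite inE first_visit_root first_visit_root_rev.
Qed.

Lemma rank_rotation_between x z : rk z = rk x -> z != x -> z != s x ->
  between (rk (a x)) (rk (a (s x))) (rk (a z)).
Proof.
by move/esym/eqP; rewrite rank_eq rank_between; apply: rotation_between.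
Qed.
End OuterWalk.
End Jordan.

(** * Rotation systems and their graphs *)

Section Isomorphism.
Implicit Types M N : rotation_system.

Definition map_rank M := rank (rot_next M) (dart_rev M) (root M).

Definition map_adjacent M := adjacent (rot_next M) (dart_rev M) (root M).

Lemma closed_setT M (S : {set 'I_(darts M)}) x : connected_map M -> x \in S ->
  {in S, forall y, rot_next M y \in S} -> {in S, forall y, dart_rev M y \in S} -> S = setT.
Proof.
move=> /forallP/(_ x)/forallP cM xS sS aS; apply/setP=> y; rewrite inE.
have /connectP[p xp ->] := cM y; elim: p x xS xp {cM} => //= z p IH x xS /andP[xz].
by apply: IH; case/orP: xz => /eqP->; auto.
Qed.

Section Invariants.
Variables (M : rotation_system) (v : nat).
Hypothesis M_ok : simple_outerplanar M v.

Lemma map_revK : involutive (dart_rev M).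
Proof. by case/and4P: M_ok => /forallP h _ _ _ x; have /andP[_ /eqP] := h x. Qed.

Lemma map_rev_neq x : dart_rev M x != x.
Proof. by case/and4P: M_ok => /forallP h _ _ _; have /andP[] := h x. Qed.

Lemma map_connected (S : {set 'I_(darts M)}) x : x \in S ->
  {in S, forall y, rot_next M y \in S} -> {in S, forall y, dart_rev M y \in S} -> S = setT.
Proof. by case/and4P: M_ok => _ cM _ _; apply: closed_setT. Qed.

Lemma map_euler :
  #|porbits (rot_next M)| + #|porbits (dart_rev M * rot_next M)%g| = #|porbits (dart_rev M)| + 2.
Proof. by case/and4P: M_ok => _ _ /eqP. Qed.

Lemma map_loopless x : dart_rev M x \notin porbit (rot_next M) x.
Proof.
case/and4P: M_ok => _ _ _ /andP[/forallP h _].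
by rewrite porbit_sym -eq_porbit_mem; apply: h.
Qed.

Lemma map_simple x y : y \in porbit (rot_next M) x ->
  dart_rev M y \in porbit (rot_next M) (dart_rev M x) -> x = y.
Proof.
case/and4P: M_ok => _ _ _ /and4P[_ /forallP/(_ x)/forallP/(_ y)/implyP h _ _] xy axy.
by apply/eqP/h; rewrite /vertex !eq_porbit_mem porbit_sym xy porbit_sym.
Qed.

Lemma map_outer x : exists2 y, y \in porbit (dart_rev M * rot_next M)%g (root M) &
  y \in porbit (rot_next M) x.
Proof.
by case/and4P: M_ok => _ _ _ /and4P[_ _ /forallP/(_ x)/existsP[y /andP[]] *]; exists y.
Qed.

Lemma map_card : #|porbits (rot_next M)| = v.
Proof. by case/and4P: M_ok => _ _ _ /and4P[_ _ _ /eqP]. Qed.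

Lemma map_rank_eq (x y : 'I_(darts M)) :
  (map_rank x == map_rank y) = (y \in porbit (rot_next M) x).
Proof. exact: (rank_eq map_outer). Qed.

Lemma map_rank_simple (x y : 'I_(darts M)) : map_rank x = map_rank y ->
  map_rank (dart_rev M x) = map_rank (dart_rev M y) -> x = y.
Proof. exact: (rank_simple map_simple map_outer). Qed.

Lemma map_rank_rot x : map_rank (rot_next M x) = map_rank x.
Proof. exact: (rank_rot map_outer). Qed.

Lemma map_rank_root : map_rank (root M) = 0.
Proof. exact: (rank_root map_outer). Qed.

Lemma map_rank_root_rev : map_rank (dart_rev M (root M)) = 1.
Proof. exact: (rank_root_rev map_loopless map_outer). Qed.

Lemma map_rank_between (x z : 'I_(darts M)) :
  map_rank z = map_rank x -> z != x -> z != rot_next M x ->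
  between (map_rank (dart_rev M x)) (map_rank (dart_rev M (rot_next M x)))
          (map_rank (dart_rev M z)).
Proof.
exact: (rank_rotation_between map_revK map_rev_neq map_connected map_euler
          map_loopless map_simple map_outer).
Qed.

Lemma map_adjacent_canonical n : v = n.+1 -> canonical n (map_adjacent M).
Proof.
move=> vn; apply: (adjacent_canonical map_revK map_rev_neq map_connected map_euler
  map_loopless map_outer); rewrite map_card vn //.
Qed.

Lemma map_adjacent_sym : symmetric (map_adjacent M).
Proof. by move=> i j; rewrite /map_adjacent (adjacent_sym _ map_revK). Qed.

Lemma map_adjacent_irrefl i : map_adjacent M i i = false.
Proof. exact: (adjacent_irrefl map_loopless map_outer). Qed.

Lemma map_adjacent_bound i j : map_adjacent M i j -> (i < v) && (j < v).
Proof. by rewrite -map_card; apply: (adjacent_bound map_outer). Qed.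
End Invariants.

Lemma iso_map_rank M N (f : 'I_(darts M) -> 'I_(darts N)) : bijective f ->
    f (root M) = root N ->
    (forall x, f (rot_next M x) = rot_next N (f x)) ->
    (forall x, f (dart_rev M x) = dart_rev N (f x)) ->
  forall x, map_rank (f x) = map_rank x.
Proof.
move=> fB f0 fs fr x; have fI := bij_inj fB.
have fporbit (s : {perm 'I_(darts M)}) (t : {perm 'I_(darts N)}) :
    (forall z, f (s z) = t (f z)) -> forall y, porbit t (f y) = f @: porbit s y.
  move=> st y; have fX i : (t ^+ i)%g (f y) = f ((s ^+ i)%g y).
    by elim: i => [|i IH]; rewrite ?perm1 // !expgSr !permM IH st.
  apply/setP=> z; apply/porbitP/imsetP => [[i ->]|[u /porbitP[i ->] ->]].
    by exists ((s ^+ i)%g y); rewrite ?mem_porbit.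
  by exists i.
have fphi z : f ((dart_rev M * rot_next M)%g z) = (dart_rev N * rot_next N)%g (f z).
  by rewrite !permM fs fr.
have fv y : first_visit (rot_next N) (dart_rev N) (root N) (f y) =
            first_visit (rot_next M) (dart_rev M) (root M) y.
  rewrite /first_visit -f0 (fporbit _ _ fphi) card_imset //.
  have -> n z : traject (dart_rev N * rot_next N)%g (f z) n =
                map f (traject (dart_rev M * rot_next M)%g z n).
    by elim: n z => //= n IH z; rewrite -fphi IH.
  rewrite find_map; apply: eq_find => z /=.
  by rewrite (fporbit _ _ fs) mem_imset.
rewrite /map_rank /rank fv.
rewrite -[RHS](card_imset _ (imset_inj fI)); apply: eq_card.
apply/setP/eqP; rewrite eqEsubset; apply/andP; split; apply/subsetP => A.
  case/imsetP=> y; have [g fK gK] := fB; rewrite inE -[y]gK fv => yx ->.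
  by rewrite (fporbit _ _ fs); apply: imset_f; apply: imset_f; rewrite inE.
case/imsetP=> B /imsetP[y]; rewrite inE => yx -> ->.
by rewrite -(fporbit _ _ fs); apply: imset_f; rewrite inE fv.
Qed.

Lemma iso_map_adjacent M N : rooted_iso M N -> map_adjacent M =2 map_adjacent N.
Proof.
case/rooted_isoP=> f fB [f0 fs fr] i j; have fR := iso_map_rank fB f0 fs fr.
apply/existsP/existsP => -[x /andP[xi xj]].
  by exists (f x); rewrite -fr [rank _ _ _ _]fR [X in _ && (X == _)]fR xi xj.
have [g fK gK] := fB; exists (g x).
by rewrite -[_ == i]/(map_rank _ == i) -[_ == j]/(map_rank _ == j) -!fR fr gK xi xj.
Qed.

(** By simplicity a dart is known from the ranks of its two ends, so equal adjacency yields a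
    bijection of darts. It respects rotations because these follow the cyclic order of the ranks,
    and the root because it is the dart from rank 0 to rank 1. *)
Lemma map_adjacent_iso M N v : simple_outerplanar M v -> simple_outerplanar N v ->
  map_adjacent M =2 map_adjacent N -> rooted_iso M N.
Proof.
have transfer P Q : simple_outerplanar P v -> simple_outerplanar Q v ->
    map_adjacent P =2 map_adjacent Q -> forall x : 'I_(darts P), exists y : 'I_(darts Q),
    (map_rank y == map_rank x) && (map_rank (dart_rev Q y) == map_rank (dart_rev P x)).
  move=> P_ok Q_ok PQ x; apply/existsP.
  have := PQ (map_rank x) (map_rank (dart_rev P x)); rewrite /map_adjacent /adjacent => <-.
  by apply/existsP; exists x; rewrite !eqxx.
move=> M_ok N_ok MN.
pose f x := xchoose (transfer _ _ M_ok N_ok MN x).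
pose g x := xchoose (transfer _ _ N_ok M_ok (fun i j => esym (MN i j)) x).
have fE x : map_rank (f x) = map_rank x /\ map_rank (dart_rev N (f x)) = map_rank (dart_rev M x).
  by have /andP[/eqP-> /eqP->] := xchooseP (transfer _ _ M_ok N_ok MN x).
have gE x : map_rank (g x) = map_rank x /\ map_rank (dart_rev M (g x)) = map_rank (dart_rev N x).
  by have /andP[/eqP-> /eqP->] := xchooseP (transfer _ _ N_ok M_ok (fun i j => esym (MN i j)) x).
have fK : cancel f g.
  by move=> x; apply: (map_rank_simple M_ok); have [e1 e2] := gE (f x); have [e3 e4] := fE x; congruence.
have gK : cancel g f.
  by move=> x; apply: (map_rank_simple N_ok); have [e1 e2] := fE (g x); have [e3 e4] := gE x; congruence.
have fr x : f (dart_rev M x) = dart_rev N (f x).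
  have [e1 e2] := fE x; have [e3 e4] := fE (dart_rev M x).
  by apply: (map_rank_simple N_ok); rewrite ?(map_revK M_ok) ?(map_revK N_ok) in e1 e2 e3 e4 *; congruence.
apply/rooted_isoP; exists f; first by exists g.
split=> // [|x].
  have := (map_rank_root M_ok, map_rank_root_rev M_ok).
  have [N0 N1] := (map_rank_root N_ok, map_rank_root_rev N_ok) => -[M0 M1].
  have [e1 e2] := fE (root M).
  by apply: (map_rank_simple N_ok); congruence.
(* If [z] were not [rot_next M x], the two maps would put the heads of these darts in opposite
   cyclic orders after that of [x]. *)
pose z := g (rot_next N (f x)).
have zf : f z = rot_next N (f x) by rewrite gK.
rewrite -zf; congr f; apply/eqP; apply: contraT => zs.
have zx : map_rank z = map_rank x.
  by rewrite -(fE z).1 zf (map_rank_rot N_ok) (fE x).1.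
have sx : rot_next M x != x.
  apply: contraNneq zs => sx; rewrite sx; apply/eqP.
  have : z \in porbit (rot_next M) x.
    by rewrite -(map_rank_eq M_ok) zx.
  by case/porbitP=> i ->; elim: i => [|i]; rewrite ?perm1 // expgSr permM => <-.
have zx' : z != x.
  apply: contraNneq sx => e; have fx : rot_next N (f x) = f x by rewrite -zf e.
  have : f (rot_next M x) \in porbit (rot_next N) (f x).
    by rewrite -(map_rank_eq N_ok) !(fE _).1 (map_rank_rot M_ok).
  case/porbitP=> i; suff -> : (rot_next N ^+ i)%g (f x) = f x by move/(can_inj fK)->.
  by elim: i => [|i IH]; rewrite ?perm1 // expgSr permM IH.
rewrite eq_sym in zs.
have b1 := map_rank_between M_ok zx zx' zs.
have b2 := @map_rank_between N v N_ok (f x) (f (rot_next M x)).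
rewrite -zf !(fE _).1 !(fE _).2 !(inj_eq (can_inj fK)) (map_rank_rot M_ok) in b2.
by have := b2 erefl sx; rewrite eq_sym zs => /(_ isT); move: b1; rewrite /between; lia.
Qed.

End Isomorphism.

(** * The map of a canonical graph *)

Section GraphMap.
Variables (n : nat) (e : rel nat).
Hypothesis e_sym : symmetric e.
Hypothesis e_irr : irreflexive e.
Hypothesis e_parent : forall j, 0 < j <= n -> exists2 i, i < j & e i j.
Hypothesis e_noncrossing :
  forall i k j l, i < k < j -> j < l <= n -> e i j -> ~~ e k l.

(** The outer walk arrives at [j] for the first time from this vertex; see [graph_walk]. *)
Definition parent j := \max_(i < j | e i j) i.

Lemma parentP j : 0 < j <= n ->
  [/\ parent j < j, e (parent j) j & forall i, i < j -> e i j -> i <= parent j].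
Proof.
move=> jn; have [i ij eij] := e_parent jn.
have [|k ek pk] := @eq_bigmax_cond _ (fun k : 'I_j => e k j) (fun k => k : nat).
  by apply/card_gt0P; exists (Ordinal ij).
rewrite /parent pk; split=> // l lj el.
by rewrite -pk; apply: (@leq_bigmax_cond _ (fun k : 'I_j => e k j) (fun k => k : nat) (Ordinal lj)).
Qed.

(* A full turn, not 0, when [i = j]. *)
Definition cyclic_distance i j := if i < j then j - i else j + n.+1 - i.

Variables (D : finType) (tl hd : D -> nat) (s a : {perm D}).
Hypothesis dart_inj : forall x y, tl x = tl y -> hd x = hd y -> x = y.
Hypothesis dart_edge : forall x, e (tl x) (hd x).
Hypothesis dart_tl : forall x, tl x <= n.
Hypothesis dart_ex : forall i j, i <= n -> j <= n -> e i j -> exists2 x, tl x = i & hd x = j.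
Hypothesis tl_rev : forall x, tl (a x) = hd x.
Hypothesis hd_rev : forall x, hd (a x) = tl x.
Hypothesis tl_rot : forall x, tl (s x) = tl x.
Hypothesis rot_min : forall x y, tl y = tl x ->
  cyclic_distance (hd x) (hd (s x)) <= cyclic_distance (hd x) (hd y).
Local Notation phi := (a * s)%g.

Lemma dart_hd x : hd x <= n.
Proof. by rewrite -tl_rev. Qed.

Lemma dart_neq x : tl x != hd x.
Proof. by apply: contraL (dart_edge x) => /eqP->; rewrite e_irr. Qed.

Lemma rot_up x y : tl y = tl x -> hd x < hd y -> hd x < hd (s x) <= hd y.
Proof.
move=> txy xy; have := rot_min txy; have := dart_hd (s x); have := dart_hd y.
by rewrite /cyclic_distance xy; case: ltnP; lia.
Qed.

Lemma rot_wrap x : (forall y, tl y = tl x -> hd y <= hd x) ->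
  forall y, tl y = tl x -> hd (s x) <= hd y.
Proof.
move=> top y yx; have := rot_min yx; have := top _ yx; have := top _ (tl_rot x).
rewrite /cyclic_distance; have := dart_hd x.
by case: (ltnP (hd x) (hd (s x))) => ?; case: (ltnP (hd x) (hd y)) => ?; lia.
Qed.

Lemma graph_revK : involutive a.
Proof. by move=> x; apply: dart_inj; rewrite ?tl_rev ?hd_rev ?tl_rev. Qed.

Lemma graph_rev_neq x : a x != x.
Proof. by apply: contra (dart_neq x) => /eqP xE; rewrite -{2}xE hd_rev. Qed.

(** Each rotation brings the head strictly closer, in cyclic distance, to the head of [y], and never
    jumps over it. *)
Lemma graph_porbit x : porbit s x = [set y | tl y == tl x].
Proof.
apply/setP=> y; rewrite inE; apply/idP/idP => [/porbitP[i ->]|/eqP yx].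
  by elim: i => [|i]; rewrite ?perm1 // expgSr permM tl_rot.
suff H m : forall z, z \in porbit s x -> cyclic_distance (hd z) (hd y) <= m -> y \in porbit s x.
  by apply: (H _ x (porbit_id _ _) (leqnn _)).
elim: m => [|m IH] z zx.
  by rewrite /cyclic_distance; have := dart_hd z; case: ltnP; lia.
have sz : s z \in porbit s x.
  by move: zx; rewrite -!eq_porbit_mem => /eqP <-; rewrite (porbit_perm s 1).
have tz : tl z = tl x.
  by case/porbitP: zx => i ->; elim: i => [|i]; rewrite ?perm1 // expgSr permM tl_rot.
move=> zm; have [e1|ne] := eqVneq (hd (s z)) (hd y).
  by have <- : s z = y by apply: dart_inj; rewrite ?tl_rot ?tz.
apply: (IH (s z)) => //; have := @rot_min z y; rewrite yx tz => /(_ erefl).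
move: zm ne; have := dart_hd z; have := dart_hd (s z); have := dart_hd y.
rewrite /cyclic_distance; case: (ltnP (hd z) (hd y)) => ?; case: (ltnP (hd z) (hd (s z))) => ?;
  by case: (ltnP (hd (s z)) (hd y)) => ?; lia.
Qed.

Lemma graph_loopless x : a x \notin porbit s x.
Proof. by rewrite graph_porbit inE tl_rev eq_sym dart_neq. Qed.

Lemma graph_simple x y : y \in porbit s x -> a y \in porbit s (a x) -> x = y.
Proof. by rewrite !graph_porbit !inE !tl_rev => /eqP e1 /eqP e2; apply: dart_inj. Qed.

Variable r : D.
Hypothesis tl_root : tl r = 0.

Lemma graph_dart i : i <= n -> exists x, tl x = i.
Proof.
case: i => [|i] iN; first by exists r.
have [k ki eki] := e_parent (j := i.+1) iN.
have [|x xi _] := dart_ex iN _ (etrans (e_sym _ _) eki); first exact: leq_trans (ltnW ki) iN.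
by exists x.
Qed.

Lemma card_tails k : k <= n.+1 -> #|[set porbit s y | y : D & tl y < k]| = k.
Proof.
move=> kn; pose h (i : 'I_k) := [set y | tl y == i].
have -> : [set porbit s y | y : D & tl y < k] = h @: setT.
  apply/setP=> A; apply/imsetP/imsetP => [[y]|[i _ ->]].
    by rewrite inE => yk ->; exists (Ordinal yk); rewrite // graph_porbit.
  have [|x xi] := @graph_dart i; first by rewrite -ltnS (leq_trans (ltn_ord i)).
  by exists x; rewrite ?inE ?graph_porbit xi.
rewrite card_imset ?cardsT ?card_ord // => i j /setP hij.
have [|x xi] := @graph_dart i; first by rewrite -ltnS (leq_trans (ltn_ord i)).
by apply: val_inj; have := hij x; rewrite !inE xi eqxx => /esym/eqP.
Qed.

Lemma graph_card : #|porbits s| = n.+1.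
Proof.
rewrite -[RHS](card_tails (leqnn _)); apply: eq_card => A.
by apply/imsetP/imsetP => -[y _ ->]; exists y; rewrite // inE ltnS.
Qed.

Lemma graph_connected (S : {set D}) x : x \in S ->
  {in S, forall y, s y \in S} -> {in S, forall y, a y \in S} -> S = setT.
Proof.
move=> xS sS aS.
have vS y z : y \in S -> tl y = tl z -> z \in S.
  move=> yS yz; have : z \in porbit s y by rewrite graph_porbit inE yz.
  by case/porbitP=> i ->; elim: i => [|i]; rewrite ?perm1 // expgSr permM; apply: sS.
have step j : 0 < j <= n -> exists2 y, tl y = j & hd y < j.
  move=> jn; have [i ij eij] := e_parent jn; have /andP[j0 jN] := jn.
  have [|y yj yi] := dart_ex jN _ (etrans (e_sym _ _) eij).
    by rewrite ltnW // (leq_trans ij).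
  by exists y; rewrite // yi.
have S0 m y : tl y <= m -> y \in S -> r \in S.
  elim: m y => [|m IH] y ym yS.
    by apply: vS yS _; rewrite tl_root; move: ym; rewrite leqn0 => /eqP.
  have [y0|y0] := posnP (tl y); first by apply: vS yS _; rewrite y0.
  have [|z zy hz] := @step (tl y); first by rewrite y0 dart_tl.
  apply: (IH (a z)); first by rewrite tl_rev -ltnS (leq_trans hz).
  by apply: aS; apply: vS yS _.
apply/setP=> y; rewrite inE; move: (leqnn (tl y)); move: {2}(tl y) => m.
elim: m y => [|m IH] y ym.
  by apply: (vS r); [exact: S0 xS|rewrite tl_root; move: ym; rewrite leqn0 => /eqP].
have [y0|y0] := posnP (tl y); first by apply: IH; rewrite y0.
have [|z zy hz] := @step (tl y); first by rewrite y0 dart_tl.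
apply: (vS z) => //; rewrite -(graph_revK z); apply/aS/IH.
by rewrite tl_rev -ltnS (leq_trans hz).
Qed.

(* Below the arc [I -- J] the boundary of a face goes down from arc to arc    *)
(* until it reaches [I]; the last two hypotheses say which arcs are already   *)
(* known not to cover the current dart.                                       *)
Lemma descend I J z x : tl z = I -> hd z = J -> I < J ->
    I <= hd x -> hd x < tl x -> tl x <= J -> (tl x != J) || (hd x != I) ->
    (forall c v, hd x < c <= J -> e c v -> I <= v -> (hd x <= v) || (c == J) && (v == I)) ->
    (forall c v, tl x < c <= J -> e c v -> I <= v -> (hd x < v) || (c == J) && (v == I)) ->
  exists2 m, iter m.+1 phi x = z &
    forall i, i <= m -> hd (iter i phi x) < tl (iter i phi x) <= tl x.
Proof.
move=> zI zJ IJ; have eIJ : e I J by rewrite -zI -zJ.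
have Jn : J <= n by rewrite -zJ dart_hd.
have [m] := ubnP (hd x); elim: m x => // m IH x xm Ix xd xJ ne inv2 inv3.
have tphi : tl (phi x) = hd x by rewrite permM tl_rot tl_rev.
have [xI|xI] := eqVneq (hd x) I.
  exists 0 => [|[_|//]]; last by rewrite /= xd leqnn.
  have zax : tl z = tl (a x) by rewrite zI tl_rev xI.
  have xJ' : tl x < J by rewrite ltn_neqAle xJ andbT; move: ne; rewrite xI eqxx orbF.
  have := rot_up zax; rewrite hd_rev zJ => /(_ xJ') /andP[lo hi].
  apply: dart_inj; rewrite /= ?tphi ?xI // zJ permM.
  have := inv3 (hd (s (a x))) I; rewrite lo hi xI ltnn eqxx !andbT leqnn /= => /(_ isT) h.
  apply/eqP; apply: h => //; rewrite e_sym; have := dart_edge (s (a x)).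
  by rewrite tl_rot tl_rev xI.
have Ilt : I < hd x by rewrite ltn_neqAle eq_sym xI.
(* Among the neighbours of [hd x], [tl x] is the highest: one in [(tl x, J]] contradicts the last
   hypothesis, and one beyond [J] would cross the arc [I -- J]. The rotation therefore wraps around
   to the lowest neighbour. *)
have top y : tl y = tl (a x) -> hd y <= hd (a x).
  rewrite tl_rev hd_rev => yx; rewrite leqNgt; apply/negP => xy.
  have exy : e (hd x) (hd y) by rewrite -yx.
  have yJ : hd y <= J.
    rewrite leqNgt; apply/negP => Jy; move: exy; apply/negP.
    by apply: (e_noncrossing (i := I) (j := J)); rewrite ?Jy ?dart_hd // Ilt (leq_trans xd).
  have := inv3 (hd y) (hd x); rewrite xy yJ ltnn (negPf xI) andbF /= => /(_ isT) h.
  by move: h; rewrite e_sym => /(_ exy (ltnW Ilt)).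
have low y : tl y = hd x -> hd (phi x) <= hd y.
  by move=> yx; rewrite permM; apply: (rot_wrap top); rewrite tl_rev.
have ephi : e (hd x) (hd (phi x)) by rewrite -tphi.
have x0 : 0 < hd x <= n by rewrite (leq_ltn_trans (leq0n I) Ilt) dart_hd.
have down : hd (phi x) < hd x.
  have [k kx ek] := e_parent x0.
  have [||y yx yk] := @dart_ex (hd x) k _ _ (etrans (e_sym _ _) ek); first exact: dart_hd.
    by rewrite ltnW // (leq_trans kx) ?dart_hd.
  by apply: leq_ltn_trans (low y yx) _; rewrite yk.
have Iphi : I <= hd (phi x).
  rewrite leqNgt; apply/negP => phiI; move: eIJ; apply/negP.
  apply: (e_noncrossing (i := hd (phi x)) (j := hd x)); rewrite ?phiI ?Jn ?Ilt //=.
    by rewrite (leq_trans xd).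
  by rewrite e_sym.
have nbr c : c <= n -> e (hd x) c -> hd (phi x) <= c.
  move=> cn ec; have [||y yx yc] := @dart_ex (hd x) c _ _ ec => //; first exact: dart_hd.
  by rewrite -yc low.
have [|||||||k kz kd] := IH (phi x); rewrite ?tphi //.
- by rewrite -ltnS; apply: leq_trans xm; rewrite ltnS.
- by rewrite ltnW // (leq_trans xd).
- by rewrite ltn_eqF // (leq_trans xd).
- move=> c v /andP[cl cJ] ecv Iv; have [xc|cx|cx] := ltngtP (hd x) c.
  + have := inv2 c v; rewrite xc cJ => /(_ isT ecv Iv) /orP[xv|->]; last by rewrite orbT.
    by rewrite (leq_trans (ltnW down) xv).
  + have [//|vl] := leqP (hd (phi x)) v; move: ecv.
    rewrite e_sym; move=> evc; exfalso; move: ephi; rewrite e_sym; apply/negP.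
    apply: (e_noncrossing (i := v) (j := c)); rewrite ?vl ?cl ?cx ?dart_hd //.
  + move: ecv; rewrite -cx => ecv; have [vn|nv] := leqP v n; first by rewrite nbr.
    by rewrite (leq_trans _ (ltnW nv)) ?dart_hd.
- move=> c v /andP[cl cJ] ecv Iv.
  have := inv2 c v; rewrite cl cJ => /(_ isT ecv Iv) /orP[xv|->]; last by rewrite orbT.
  by rewrite (leq_trans down xv).
exists k.+1; first by rewrite iterSr.
move=> [|i] ik; first by rewrite xd leqnn.
by rewrite iterSr; have /andP[-> /leq_trans ->] := kd i ik; rewrite ?tphi // ltnW.
Qed.

(** After [x] the boundary descends below its arc, by [descend], until it closes up at [x]. Such a
    face is thus labelled by its only upward dart. *)
Lemma inner_face x y : tl x < hd x -> tl x != parent (hd x) ->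
  y \in porbit phi x -> tl y < hd y -> y = x.
Proof.
move=> xu xp; set i := tl x in xu xp *; set j := hd x in xu xp *.
have jn : 0 < j <= n by rewrite (leq_ltn_trans (leq0n i) xu) dart_hd.
have eij : e i j := dart_edge x.
have [pj ep pm] := parentP jn.
have ip : i < parent j by rewrite ltn_neqAle xp pm.
have tphi : tl (phi x) = j by rewrite permM tl_rot tl_rev.
have up z : tl z = j -> i < hd z -> i < hd (phi x) <= hd z.
  by move=> zj iz; have := @rot_up (a x) z; rewrite tl_rev hd_rev -permM; apply.
have dart_nbr c : c <= n -> e j c -> exists2 z, tl z = j & hd z = c.
  by move=> cn ec; apply: dart_ex; rewrite ?dart_hd.
(* The first neighbour of [j] above [i] is at most [parent j], hence below [j]: the walk goes on
   under the arc of [x]. *)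
have lo_hi : i < hd (phi x) <= parent j.
  have [||z zj zp] := dart_nbr (parent j); first by rewrite ltnW // (leq_trans pj) ?dart_hd.
    by rewrite e_sym.
  by rewrite -zp; apply: up; rewrite ?zp.
have /andP[lo hi] := lo_hi.
have [||||||m xm xd] := @descend i j x (phi x) erefl erefl xu; rewrite ?tphi //.
- exact: ltnW.
- exact: leq_ltn_trans hi pj.
- by rewrite (gtn_eqF lo) orbT.
- move=> c v /andP[cl cj] ecv iv; have [cj'|jc|cj'] := ltngtP c j; last first.
  + rewrite andTb orbC; have [//|vi] := eqVneq v i.
    have [vn|nv] := leqP v n; last by rewrite (leq_trans _ (ltnW nv)) ?dart_hd.
    rewrite cj' in ecv; have [z zj zv] := dart_nbr v vn ecv.
    have iz : i < hd z by rewrite zv ltn_neqAle eq_sym vi.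
    by rewrite -zv; have /andP[] := up z zj iz.
  + by move: cj; rewrite leqNgt jc.
  + rewrite orbF leqNgt; apply/negP => vl.
    have : e (hd (phi x)) j by rewrite e_sym -tphi.
    apply/negP; apply: (e_noncrossing (i := v) (j := c)); rewrite ?vl ?cl ?cj' ?dart_hd //.
    by rewrite e_sym.
- by move=> c v; lia.
move=> /porbitP[k ->]; rewrite permX.
have per q : iter (q * m.+2) phi x = x.
  by elim: q => // q IH; rewrite mulSn iterD IH iterSr.
rewrite (divn_eq k m.+2) addnC iterD per; move: (k %% m.+2) (ltn_pmod k (isT : 0 < m.+2)).
case=> [//|l lm]; rewrite iterSr; have /andP[h _] := xd l lm.
by move=> /(ltn_trans h); rewrite ltnn.
Qed.

(** From [j] the walk either goes straight to [j.+1], when [j] is its parent, or descends below the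
    arc from [parent j.+1] to [j.+1] and then follows that arc. *)
Lemma outer_step j x y : 0 < j < n -> hd x = j -> tl x = parent j ->
    hd y = j.+1 -> tl y = parent j.+1 ->
  exists2 m, iter m.+1 phi x = y & forall i, i <= m.+1 -> tl (iter i phi x) <= j.
Proof.
move=> /andP[j0 jn] xj xp yj yp.
have j0n : 0 < j <= n by rewrite j0 ltnW.
have [pj ep pm] := parentP j0n; have [qj eq qm] := parentP (j := j.+1) jn.
have tphi : tl (phi x) = j by rewrite permM tl_rot tl_rev.
have dart_nbr c : c <= n -> e j c -> exists2 z, tl z = j & hd z = c.
  by move=> cn ec; apply: dart_ex; rewrite ?(ltnW jn).
have edge z : tl z = j -> e j (hd z) by move=> <-.
have tax : tl (a x) = j by rewrite tl_rev.
have hax : hd (a x) = parent j by rewrite hd_rev.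
have nopar c : parent j < c -> c < j -> e j c = false.
  by move=> pc cj; apply/negP; rewrite e_sym => /(pm _ cj); lia.
have [qj'|qj'] := eqVneq (parent j.+1) j.
  exists 0 => [|[|[|//]] _ /=]; [|by rewrite xp ltnW|by rewrite tphi].
  apply: dart_inj => /=; first by rewrite tphi yp qj'.
  have tya : tl y = tl (a x) by rewrite tax yp qj'.
  have := rot_up tya; rewrite hax yj -permM ltnS (ltnW pj) => /(_ isT) /andP[lo].
  rewrite leq_eqVlt ltnS => /orP[/eqP//|hj].
  have ephi := edge _ tphi; have [hE|hN] := eqVneq (hd (phi x)) j.
    by rewrite hE e_irr in ephi.
  by rewrite nopar // ltn_neqAle hN in ephi.
have qlt : parent j.+1 < j by rewrite ltn_neqAle qj' -ltnS.
(* Such an edge would make [j] a larger parent of [j.+1], or cross the arc from [parent j.+1] to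
   [j.+1]. *)
have noup c : j < c -> c <= n -> e j c = false.
  move=> jc cn; have [cE|cE] := eqVneq c j.+1.
    by rewrite cE; apply/negP => /(qm _ (ltnSn j)); lia.
  apply/negbTE; apply: (e_noncrossing (i := parent j.+1) (j := j.+1)); rewrite ?qlt ?cn ?andbT //=.
  by rewrite ltn_neqAle eq_sym cE.
have low z : tl z = j -> hd (phi x) <= hd z.
  move=> zj; rewrite permM; apply: rot_wrap; last by rewrite tax.
  move=> u; rewrite tax hax => uj; rewrite leqNgt; apply/negP => pu.
  have eu := edge u uj; have [ju|uj'|uE] := ltngtP j (hd u).
  - by rewrite noup ?dart_hd in eu.
  - by rewrite nopar in eu.
  - by rewrite -uE e_irr in eu.
have ephi : e j (hd (phi x)) := edge _ tphi.
have lowp : hd (phi x) <= parent j.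
  by have [||z zj <-] := dart_nbr (parent j); rewrite ?low // 1?e_sym // ltnW // (leq_trans pj) // ltnW.
have qphi : parent j.+1 <= hd (phi x).
  rewrite leqNgt; apply/negP => lt.
  have := e_noncrossing (i := hd (phi x)) (k := parent j.+1) (j := j) (l := j.+1).
  by rewrite lt qlt ltnSn jn e_sym ephi eq => /(_ isT isT isT).
have last_nbr v : e j.+1 v -> parent j.+1 <= v -> v != parent j.+1 -> hd (phi x) < v.
  move=> ev qv vq; have [vj|jv] := ltnP v j.+1.
    by have := qm v vj; rewrite e_sym => /(_ ev); lia.
  by rewrite (leq_trans _ jv) // ltnS (leq_trans lowp) // ltnW.
have [|||||||m my md] := @descend (parent j.+1) j.+1 y (phi x) yp yj; rewrite ?tphi //.
- exact: leq_ltn_trans lowp pj.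
- by rewrite ltn_eqF.
- move=> c v /andP[cl cj] ecv qv; have [cE|cN] := eqVneq c j.+1.
    have [_|vq] := eqVneq v (parent j.+1); first by rewrite orbT.
    by rewrite ltnW // last_nbr // -cE.
  rewrite orbF; have [cj'|jc|cE] := ltngtP c j; last first.
  + have [vn|nv] := leqP v n; last by rewrite (leq_trans _ (ltnW nv)) ?dart_hd.
    by rewrite cE in ecv; have [z zj <-] := dart_nbr v vn ecv; rewrite low.
  + by move: cj cN; rewrite leq_eqVlt ltnS leqNgt jc orbF => /eqP->; rewrite eqxx.
  + rewrite leqNgt; apply/negP => vl; move: ephi; rewrite e_sym; apply/negP.
    apply: (e_noncrossing (i := v) (j := c)); rewrite ?vl ?cl ?cj' ?(ltnW jn) //.
    by rewrite e_sym.
- move=> c v /andP[jc cj] ecv qv; have cE : c = j.+1 by lia.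
  rewrite cE eqxx /=; have [_|vq] := eqVneq v (parent j.+1); first by rewrite orbT.
  by rewrite last_nbr // -cE.
exists m.+1; first by rewrite iterSr.
case=> [_|i im]; first by rewrite /= xp ltnW.
have [->|] := eqVneq i m.+1; first by rewrite -[iter _ _ _]/(iter m.+2 phi x) iterSr my yp ltnW.
move=> ne; have im' : i <= m by lia.
by rewrite iterSr; have /andP[_ h] := md i im'; rewrite -tphi.
Qed.

(** * The outer walk and Euler's formula for the map of a graph *)

Hypothesis hd_root : hd r = 1.

Lemma root_parent : tl r = parent (hd r).
Proof.
have [|p1 _ _] := @parentP (hd r); first by rewrite dart_hd hd_root.
by rewrite tl_root; move: p1; rewrite hd_root; case: (parent 1).
Qed.

(** Up to time [t] exactly the vertices below [j] have been met, and the next step reaches [j]; so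
    the first visits occur in numerical order. *)
Lemma graph_walk j : 0 < j <= n ->
  exists t, [/\ hd (iter t phi r) = j, tl (iter t phi r) = parent j,
    forall i, i <= t -> tl (iter i phi r) < j &
    forall k, k < j -> exists2 i, i <= t & tl (iter i phi r) = k].
Proof.
elim: j => // -[|j] IH jn.
  exists 0; split=> [||i|k] /=.
  - exact: hd_root.
  - by rewrite root_parent hd_root.
  - by rewrite leqn0 => /eqP->; rewrite /= tl_root.
  - by case: k => // _; exists 0.
have jn' : 0 < j.+1 < n by [].
have [|t [ht tt lt vt]] := IH; first exact: ltnW jn'.
have [pj ep _] := @parentP j.+2 jn.
have [|y yp yj] := dart_ex (i := parent j.+2) _ jn ep; first exact: ltnW (leq_trans pj jn).
have [m ym lm] := outer_step jn' ht tt yj yp.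
have iter_t i : iter (t + i) phi r = iter i phi (iter t phi r) by rewrite addnC iterD.
exists (t + m.+1); rewrite iter_t ym; split=> // [i it|k].
  have [ti|it'] := leqP t i; last by rewrite ltnS ltnW // lt // ltnW.
  by rewrite -(subnKC ti) iter_t ltnS lm // leq_subLR.
rewrite ltnS leq_eqVlt => /orP[/eqP->|/vt[i it <-]]; last first.
  by exists i; rewrite // (leq_trans it) // leq_addr.
exists t.+1; first by rewrite addnS ltnS leq_addr.
by rewrite iterS permM tl_rot tl_rev.
Qed.

Lemma graph_outer x : exists2 y, y \in porbit phi r & y \in porbit s x.
Proof.
have wr i : iter i phi r \in porbit phi r by rewrite -permX mem_porbit.
have [x0|x0] := posnP (tl x).
  by exists r; rewrite ?porbit_id // graph_porbit inE tl_root x0.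
have [|t [ht _ _ _]] := @graph_walk (tl x); first by rewrite x0 dart_tl.
exists (iter t.+1 phi r); first exact: wr.
by rewrite graph_porbit inE iterS permM tl_rot tl_rev ht.
Qed.

Lemma graph_first_visit x y : (first_visit s a r x < first_visit s a r y) = (tl x < tl y).
Proof.
have lt u v : tl u < tl v -> first_visit s a r u < first_visit s a r v.
  move=> uv; have [uL uw umin] := first_visitP graph_outer u.
  have [vL vw vmin] := first_visitP graph_outer v.
  have [|t [_ _ lt tv]] := @graph_walk (tl v).
    by rewrite dart_tl (leq_ltn_trans (leq0n _) uv).
  have tv' : t < first_visit s a r v.
    rewrite ltnNge; apply/negP => /lt; move: vw.
    by rewrite graph_porbit inE => /eqP->; rewrite ltnn.
  have [i it iu] := tv _ uv; apply: (leq_ltn_trans _ tv'); apply: (leq_trans _ it).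
  apply: umin; last by rewrite graph_porbit inE iu.
  exact: leq_ltn_trans it (ltn_trans tv' vL).
apply/idP/idP; last exact: lt.
apply: contraTT; rewrite -!leqNgt leq_eqVlt => /orP[/eqP yx|/lt/ltnW//].
by rewrite eq_leq //; apply/eqP; rewrite (first_visit_eq graph_outer) graph_porbit inE yx.
Qed.

Lemma graph_rank x : rank s a r x = tl x.
Proof.
rewrite -[RHS](@card_tails (tl x)) ?leqW ?dart_tl //; apply: eq_card => A.
by apply/imsetP/imsetP => -[y]; rewrite inE => yx ->; exists y;
   rewrite // inE ?graph_first_visit // -graph_first_visit.
Qed.

Lemma graph_adjacent i j : i <= n -> j <= n -> adjacent s a r i j = e i j.
Proof.
move=> iN jN; apply/existsP/idP => [[x]|eij].
  by rewrite !graph_rank tl_rev => /andP[/eqP<- /eqP<-].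
by have [x xi xj] := dart_ex iN jN eij; exists x; rewrite !graph_rank tl_rev xi xj !eqxx.
Qed.

(** One inequality is [genus_ge0]. For the other, at most [n] upward darts are parent darts, one per
    nonzero vertex; every other upward dart has its own face by [inner_face], and none of these is
    the face of [r], whose dart is a parent dart. *)
Lemma graph_euler : #|porbits s| + #|porbits phi| = #|porbits a| + 2.
Proof.
have zD := card_porbits_involution graph_revK graph_rev_neq.
have c1 : ncomponents s a <= 1.
  rewrite /ncomponents -(cards1 [set: D]); apply/subset_leq_card/subsetP.
  move=> A /imsetP[x _ ->]; rewrite inE; apply/eqP.
  by apply: (graph_connected (x := x)) => [|y|y];
     rewrite ?component_refl ?component_rot ?component_rev.
pose up := [set x | tl x < hd x].
have upE : #|up| = #|porbits a|.
  have : #|D| = #|up| + #|a @: up|.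
    rewrite -cardsT -(cardsID up [set: D]) setTI setTD; congr (_ + #|pred_of_set _|).
    apply/setP=> x; rewrite -{2}(graph_revK x) mem_imset ?inE; last exact: perm_inj.
    by rewrite tl_rev hd_rev -leqNgt leq_eqVlt eq_sym (negPf (dart_neq x)).
  by rewrite (card_imset _ perm_inj) -zD; lia.
pose par := [set x in up | tl x == parent (hd x)].
have parE : #|par| <= n.
  have hdP x : hd x < n.+1 by rewrite ltnS dart_hd.
  have inj : {in par &, injective (fun x => Ordinal (hdP x))}.
    move=> x y; rewrite !inE => /andP[_ /eqP xp] /andP[_ /eqP yp] /(congr1 val) /= xy.
    by apply: dart_inj; rewrite // xp yp xy.
  rewrite -(card_in_imset inj) -ltnS -[X in _ < X]card_ord -cardsT; apply: proper_card.
  apply/properP; split=> //; exists ord0 => //; apply/negP => /imsetP[x].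
  by rewrite !inE => /andP[xu _] /(congr1 val) /= x0; rewrite -x0 in xu.
have rpar : r \in par by rewrite !inE -root_parent tl_root hd_root eqxx.
pose faces := porbit phi @: (r |: (up :\: par)).
have facesE : #|faces| = #|up :\: par|.+1.
  have inner x y : x \in up :\: par -> y \in up -> porbit phi x = porbit phi y -> y = x.
    rewrite !inE => /andP[+ xu] yu /eqP; rewrite xu eq_porbit_mem porbit_sym => xp yx.
    exact: inner_face xu xp yx yu.
  rewrite card_in_imset; last first.
    have ru : r \in up by move: rpar; rewrite inE => /andP[].
    have sub : {subset up :\: par <= up} by move=> x; rewrite inE => /andP[].
    move=> x y; rewrite 2!in_setU1 => /orP[/eqP->|xu] /orP[/eqP->|yu] //.
    - by move=> ry; apply: inner yu ru (esym ry).
    - by move=> xr; apply: esym; apply: inner xu ru xr.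
    - by move=> xy; apply: esym; apply: inner xu (sub _ yu) xy.
  by rewrite cardsU1 inE rpar.
have facesF : #|faces| <= #|porbits phi|.
  by apply/subset_leq_card/subsetP=> _ /imsetP[x _ ->]; apply: imset_f.
have := genus_ge0 s a; have := cardsID par up.
have -> : up :&: par = par by apply/setIidPr/subsetP=> x; rewrite inE => /andP[].
by rewrite graph_card; lia.
Qed.
End GraphMap.

(** * Existence of a map with a given canonical graph *)

Definition undirected (e : rel nat) : rel nat :=
  fun i j => if i < j then e i j else (j < i) && e j i.

Lemma undirected_sym e : symmetric (undirected e).
Proof. by move=> i j; rewrite /undirected; case: ltngtP. Qed.

Lemma undirected_irr e : irreflexive (undirected e).
Proof. by move=> i; rewrite /undirected ltnn. Qed.

(** Used for the injectivity of the rotation: two different neighbours cannot have the same cyclic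
    successor. *)
Lemma cyclic_distance_inj n u v w : u <= n -> v <= n -> w <= n ->
  cyclic_distance n u w <= cyclic_distance n u v ->
  cyclic_distance n v w <= cyclic_distance n v u -> u = v.
Proof.
rewrite /cyclic_distance => un vn wn.
by case: (ltngtP u v) => ?; case: (ltnP u w) => ?; case: (ltnP v w) => ?; lia.
Qed.

(** The darts are the ordered pairs of adjacent vertices, and the rotation moves to the next
    neighbour in cyclic order. *)
Lemma canonical_map n e : 0 < n -> canonical n e ->
  exists2 M, simple_outerplanar M n.+1 &
    forall i j, i < j <= n -> map_adjacent M i j = e i j.
Proof.
move=> n0 [e_par e_nc]; pose g := undirected e.
have g_lt i j : i < j -> g i j = e i j by rewrite /g /undirected => ->.
pose A := [set p : 'I_n.+1 * 'I_n.+1 | g p.1 p.2].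
pose D := 'I_#|A|.
pose tl (x : D) : nat := (enum_val x).1; pose hd (x : D) : nat := (enum_val x).2.
have revA (x : D) : ((enum_val x).2, (enum_val x).1) \in A.
  by have := enum_valP x; rewrite !inE /g undirected_sym.
pose rev x : D := enum_rank_in (revA x) ((enum_val x).2, (enum_val x).1).
have tl_rev x : tl (rev x) = hd x by rewrite /tl enum_rankK_in.
have hd_rev x : hd (rev x) = tl x by rewrite /hd enum_rankK_in.
have dart_inj x y : tl x = tl y -> hd x = hd y -> x = y.
  move=> e1 e2; apply: enum_val_inj; apply/eqP.
  by rewrite -pair_eqE /= -!val_eqE /= [X in X == _]e1 [X in _ && (X == _)]e2 !eqxx.
have rev_inj : injective rev.
  by move=> x y xy; apply: dart_inj; rewrite -?hd_rev -?tl_rev xy.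
pose rot x : D := [arg min_(y < x | tl y == tl x) cyclic_distance n (hd x) (hd y)].
have rotP x : tl (rot x) = tl x /\ forall y, tl y = tl x ->
    cyclic_distance n (hd x) (hd (rot x)) <= cyclic_distance n (hd x) (hd y).
  by rewrite /rot; case: arg_minnP => //= y /eqP yx ymin; split=> // z zx; rewrite ymin ?zx.
have hd_n x : hd x <= n by rewrite -ltnS /hd.
have rot_inj : injective rot.
  move=> x y xy; have [x1 x2] := rotP x; have [y1 y2] := rotP y.
  have txy : tl x = tl y by rewrite -x1 -y1 xy.
  apply: dart_inj => //; apply: (@cyclic_distance_inj n _ _ (hd (rot x))) => //.
    exact: x2.
  by rewrite xy; apply: y2.
have dart_ex i j : i <= n -> j <= n -> g i j -> exists2 x, tl x = i & hd x = j.
  rewrite -ltnS => iN; rewrite -ltnS => jN gij.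
  have pA : (Ordinal iN, Ordinal jN) \in A by rewrite inE.
  by exists (enum_rank_in pA (Ordinal iN, Ordinal jN)); rewrite /tl /hd enum_rankK_in.
have g_par j : 0 < j <= n -> exists2 i, i < j & g i j.
  by move=> jn; have [i ij eij] := e_par j jn; exists i; rewrite ?g_lt.
have g_nc i k j l : i < k < j -> j < l <= n -> g i j -> ~~ g k l.
  move=> /andP[ik kj] /andP[jl ln]; rewrite (g_lt _ _ (ltn_trans ik kj)) (g_lt _ _ (ltn_trans kj jl)).
  by apply: e_nc; rewrite ?ik ?jl.
have [|r r0 r1] := @dart_ex 0 1 (leq0n n) n0.
  by have [|[] // _ e01] := e_par 1; rewrite ?g_lt.
pose M := @RotationSystem #|A| (perm rot_inj) (perm rev_inj) r.
have dart_edge x : g (tl x) (hd x) by have := enum_valP x; rewrite inE.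
have tl_n x : tl x <= n by rewrite -ltnS /tl.
pose s := perm rot_inj; pose a := perm rev_inj.
have tl_a x : tl (a x) = hd x by rewrite permE.
have hd_a x : hd (a x) = tl x by rewrite permE.
have tl_s x : tl (s x) = tl x by rewrite permE; have [] := rotP x.
have s_min x y : tl y = tl x ->
    cyclic_distance n (hd x) (hd (s x)) <= cyclic_distance n (hd x) (hd y).
  by rewrite permE; have [_] := rotP x; apply.
have g_sym : symmetric g := @undirected_sym e.
have g_irr : irreflexive g := @undirected_irr e.
have aK := graph_revK dart_inj tl_a hd_a.
have a_neq := graph_rev_neq g_irr dart_edge hd_a.
exists M; last first.
  move=> i j /andP[ij jn]; rewrite /map_adjacent -(g_lt i j) //.
  apply: (graph_adjacent g_sym g_irr g_par g_nc dart_inj dart_edge tl_n dart_ex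
            tl_a hd_a tl_s s_min r0 r1) => //.
  exact: leq_trans (ltnW ij) jn.
have loop := graph_loopless g_irr dart_inj dart_edge tl_n tl_a tl_s s_min.
have simp := graph_simple dart_inj tl_n tl_a tl_s s_min.
have out := graph_outer g_sym g_irr g_par g_nc dart_inj dart_edge tl_n dart_ex
            tl_a hd_a tl_s s_min r0 r1.
have conn := graph_connected g_sym g_par dart_inj tl_n dart_ex
            tl_a hd_a tl_s s_min r0.
apply/and5P; split.
- by apply/forallP=> x; rewrite a_neq aK eqxx.
- apply/forallP=> x; apply/forallP=> y.
  pose C := [set z | connect (fun u v => (v == s u) || (v == a u)) x z].
  suff CT : C = setT by have : y \in C; [rewrite CT inE|rewrite inE].
  apply: (conn C x) => [|z|z]; rewrite !inE ?connect0 // => xz; apply: connect_trans xz _.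
    by apply: connect1; rewrite eqxx.
  by apply: connect1; rewrite eqxx orbT.
- apply/eqP; apply: (graph_euler g_sym g_irr g_par g_nc dart_inj dart_edge tl_n dart_ex
            tl_a hd_a tl_s s_min r0 r1).
- by apply/forallP=> x; rewrite /vertex eq_porbit_mem porbit_sym; apply: loop.
apply/and3P; split.
- apply/forallP=> x; apply/forallP=> y; apply/implyP=> /andP[/eqP xy /eqP axy].
  by apply/eqP/simp; rewrite porbit_sym -eq_porbit_mem; apply/eqP.
- by apply/forallP=> x; apply/existsP; have [y y1 y2] := out x; exists y; apply/andP.
- apply/eqP; apply: (graph_card g_sym g_par dart_inj tl_n dart_ex tl_a tl_s s_min r0).
Qed.

(** * Counting canonical graphs *)

(* Counts the ways to add [n] vertices next to a stack of [h] visible ones;   *)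
(* [extend h] chooses the neighbours of the next vertex from the top down.    *)
Fixpoint graph_count (n h : nat) : nat :=
  if n is n'.+1 then
    (fix extend h := if h is h'.+1 then graph_count n' h.+1 + 2 * extend h' else 0) h
  else 1.

Lemma graph_countS0 n : graph_count n.+1 0 = 0. Proof. by []. Qed.

Section GraphCodes.

Fixpoint choices (st : seq nat) : seq (seq nat) :=
  if st is v :: st' then [:: v] :: choices st' ++ [seq v :: T | T <- choices st'] else [::].

(** Lists run downwards, so [last 0 T] is the smallest neighbour of [k]; its arc to [k] covers the
    stack vertices above it. *)
Definition next_stack k st (T : seq nat) := k :: [seq u <- st | u <= last 0 T].

(* The list of the lists [smaller e 1, ..., smaller e n] below, for canonical *)
(* graphs [e]: the stack [st] holds the vertices that no arc covers yet.      *)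
Fixpoint codes (n k : nat) (st : seq nat) : seq (seq (seq nat)) :=
  if n is n'.+1 then
    [seq T :: L | T <- choices st, L <- codes n' k.+1 (next_stack k st T)]
  else [:: [::]].

Lemma mem_choices st T : (T \in choices st) = (T != [::]) && subseq T st.
Proof.
elim: st T => [|v st IH] T /=; first by case: T.
rewrite in_cons mem_cat; case: T => [|x T].
  by rewrite IH /=; apply/mapP=> -[].
rewrite IH /= eqseq_cons; case: (eqVneq x v) => [->|xv] /=; last first.
  by rewrite orbC; case: mapP => //= -[U _ [xv']]; rewrite xv' eqxx in xv.
rewrite (mem_map (f := cons v)) ?IH; last by move=> ? ? [].
case: (eqVneq T [::]) => [->|_] /=; first by rewrite sub0seq.
by case: (boolP (subseq (v :: T) st)) => //= /(subseq_trans (subseq_cons T v)) ->.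
Qed.

Lemma choices_uniq st : uniq st -> uniq (choices st).
Proof.
elim: st => //= v st IH /andP[vst /IH Uc].
have vT T : v :: T \notin choices st.
  rewrite mem_choices; apply/negP => /andP[_ /mem_subseq/(_ v)].
  by rewrite mem_head (negPf vst) => /(_ isT).
rewrite mem_cat negb_or vT cat_uniq Uc map_inj_uniq ?Uc ?andbT /=; last by move=> ? ? [].
apply/andP; split; first by apply/mapP=> -[T + [T0]]; rewrite mem_choices -T0.
by apply/hasPn=> _ /mapP[T _ ->].
Qed.

Lemma last_choices st T : T \in choices st -> last 0 T \in st.
Proof.
rewrite mem_choices; case: T => [//|x T] /mem_subseq sub.
by apply: sub; rewrite /= mem_last.
Qed.

Lemma next_stack_sorted k st T : sorted gtn st -> all (ltn^~ k) st ->
  sorted gtn (next_stack k st T) /\ all (ltn^~ k.+1) (next_stack k st T).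
Proof.
move=> st_s st_k; have gtn_trans : transitive gtn by move=> ? ? ? /[swap]; apply: ltn_trans.
split.
  rewrite /= path_sortedE // sorted_filter // andbT.
  by apply/allP=> u; rewrite mem_filter => /andP[_ /(allP st_k)].
rewrite /= ltnSn; apply/allP=> u; rewrite mem_filter => /andP[_ /(allP st_k)].
exact: ltnW.
Qed.

Lemma gtn_sorted_uniq s : sorted gtn s -> uniq s.
Proof.
apply: sorted_uniq => [? ? ? /[swap]|?]; [exact: ltn_trans|exact: ltnn].
Qed.

Lemma codes_uniq n k st : sorted gtn st -> all (ltn^~ k) st -> uniq (codes n k st).
Proof.
elim: n k st => //= n IH k st st_s st_k; apply: allpairs_uniq_dep.
- exact/choices_uniq/gtn_sorted_uniq.
- by move=> T _; have [] := next_stack_sorted T st_s st_k; apply: IH.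
- by move=> [T L] [T' L'] _ _ /= [-> ->].
Qed.

(** Either the top [v] is the only neighbour and the whole stack survives, or the smallest neighbour
    lies in [st] and [v] gets covered, whether chosen or not: hence the factor 2. *)
Lemma sumn_choices (F : nat -> nat) v st : sorted gtn (v :: st) ->
  sumn [seq F (size [seq u <- v :: st | u <= last 0 T]) | T <- choices (v :: st)] =
  F (size st).+1 +
    2 * sumn [seq F (size [seq u <- st | u <= last 0 T]) | T <- choices st].
Proof.
move=> vst; have /allP lt_v : all (gtn v) st.
  by move: vst; rewrite /= path_sortedE => [/andP[]|? ? ? /[swap]] //; apply: ltn_trans.
rewrite [choices (v :: st)]/= map_cons [sumn (_ :: _)]/= leqnn /=.
have -> : [seq u <- st | u <= v] = st by apply/all_filterP/allP=> u /lt_v /ltnW.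
congr (_ + _); rewrite map_cat sumn_cat -map_comp mul2n -addnn; congr (sumn _ + sumn _);
  apply/eq_in_map => T Tst /=.
  have lv : last 0 T < v := lt_v _ (last_choices Tst).
  by rewrite leqNgt lv.
have : last 0 T < v := lt_v _ (last_choices Tst).
by move: Tst; rewrite mem_choices; case: T => //= x T _ lv; rewrite leqNgt lv.
Qed.

Lemma size_codes n k st : sorted gtn st -> all (ltn^~ k) st ->
  size (codes n k st) = graph_count n (size st).
Proof.
elim: n k st => //= n IH k st st_s st_k; rewrite size_allpairs_dep.
transitivity (sumn [seq graph_count n (size [seq u <- st | u <= last 0 T]).+1 | T <- choices st]).
  congr sumn; apply: eq_map => T.
  by have [s1 s2] := next_stack_sorted T st_s st_k; rewrite IH.
elim: st st_s {st_k} => // v st IHst vst.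
rewrite (sumn_choices (fun h => graph_count n h.+1)) // IHst //.
by move: vst => /=; apply: path_sorted.
Qed.

(** * Canonical graphs correspond to codes *)

Definition smaller (e : rel nat) j := [seq i <- rev (iota 0 j) | e i j].

Definition graph_code n (e : rel nat) := [seq smaller e j | j <- iota 1 n].

Definition uncovered (e : rel nat) k v : bool :=
  all (fun b => all (fun a => ~~ e a b) (iota 0 v)) (iota v.+1 (k - v.+1)).

Definition visible (e : rel nat) k := [seq v <- rev (iota 0 k) | uncovered e k v].

Lemma uncoveredP e k v :
  reflect (forall a b, a < v -> v < b < k -> ~~ e a b) (uncovered e k v).
Proof.
apply: (iffP allP) => [h a b av /andP[vb bk]|h b bP].
  have /h/allP/(_ a) : b \in iota v.+1 (k - v.+1) by rewrite mem_iota; lia.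
  by rewrite mem_iota; apply.
apply/allP=> a; rewrite mem_iota => /andP[_ av]; apply: h => //.
by move: bP; rewrite mem_iota; lia.
Qed.

Lemma mem_smaller e j i : (i \in smaller e j) = (i < j) && e i j.
Proof. by rewrite mem_filter mem_rev mem_iota andbC. Qed.

Lemma rev_iota_sorted k : sorted gtn (rev (iota 0 k)).
Proof. by rewrite rev_sorted; apply: iota_ltn_sorted. Qed.

Lemma gtn_trans : transitive gtn.
Proof. by move=> ? ? ? /[swap]; apply: ltn_trans. Qed.

Lemma sorted_last s u : sorted gtn s -> u \in s -> last 0 s <= u.
Proof.
case: s => // v s /=; elim: s v u => [|w s IH] v u /=; first by rewrite inE => _ /eqP->.
move=> /andP[vw ws]; rewrite inE => /orP[/eqP->|]; last exact: IH.
by apply: leq_trans (IH w w ws (mem_head _ _)) (ltnW vw).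
Qed.

(** The arcs from smaller vertices to [k] cover together exactly what the longest of them covers. *)
Lemma visibleS e k : smaller e k != [::] ->
  visible e k.+1 = next_stack k (visible e k) (smaller e k).
Proof.
move=> ek; rewrite /visible /next_stack.
have -> : rev (iota 0 k.+1) = k :: rev (iota 0 k) by rewrite -addn1 iotaD rev_cat.
rewrite /=.
have -> : uncovered e k.+1 k by apply/uncoveredP=> a b; lia.
congr cons; rewrite -filter_predI; apply: eq_in_filter => v.
rewrite mem_rev mem_iota add0n => /andP[_ vk] /=.
have s_s : sorted gtn (smaller e k) by exact: sorted_filter gtn_trans _ _ (rev_iota_sorted _).
have : last 0 (smaller e k) \in smaller e k by case: (smaller e k) ek => // x s _; apply: mem_last.
rewrite mem_smaller => /andP[lk el].
apply/uncoveredP/andP => [h|[vl /uncoveredP h] a b av /andP[vb]].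
  split; last by apply/uncoveredP=> a b av /andP[vb bk]; rewrite h // vb ltnW.
  by rewrite leqNgt; apply/negP => /h h'; have := h' k; rewrite vk ltnSn el => /(_ isT).
rewrite ltnS leq_eqVlt => /orP[/eqP->|bk]; last by rewrite h // vb.
apply/negP => ea; have := @sorted_last _ a s_s.
by rewrite mem_smaller ea (ltn_trans av vk) => /(_ isT); lia.
Qed.

Lemma mem_codes_map e m k :
  ([seq smaller e j | j <- iota k m] \in codes m k (visible e k)) <->
  (forall j, k <= j < k + m -> (smaller e j != [::]) && subseq (smaller e j) (visible e j)).
Proof.
elim: m k => [|m IH] k /=; first by split=> // _ j; lia.
split=> [/allpairsPdep[T [L [Tc Lc [TE LE]]]] j jk|h].
  have ck : (smaller e k != [::]) && subseq (smaller e k) (visible e k).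
    by rewrite -mem_choices TE.
  have [->//|jk'] := eqVneq j k; have [IHk _] := IH k.+1; apply: IHk; last by lia.
  by rewrite LE visibleS ?TE //; case/andP: ck; rewrite TE.
have /andP[k0 ks] := h k (introT andP (conj (leqnn k) (ltac:(lia) : k < k + m.+1))).
apply/allpairsPdep; exists (smaller e k), [seq smaller e j | j <- iota k.+1 m].
rewrite mem_choices k0 ks -visibleS //; split=> //.
by have [_ IHk] := IH k.+1; apply: IHk => j jk; apply: h; lia.
Qed.

(** Having a smaller neighbour means that the list of choices is nonempty, and noncrossing means
    that all smaller neighbours are still visible. *)
Lemma mem_graph_code n e : (graph_code n e \in codes n 1 [:: 0]) <-> canonical n e.
Proof.
have -> : [:: 0] = visible e 1 by [].
rewrite mem_codes_map; split=> [h|[par nc] j jn].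
  split=> [j jn|i k j l /andP[ik kj] /andP[jl ln] eij].
    have /andP[s0 _] := h j ltac:(lia).
    have : head 0 (smaller e j) \in smaller e j by case: (smaller e j) s0 => // x s _; apply: mem_head.
    by rewrite mem_smaller => /andP[]; exists (head 0 (smaller e j)).
  apply/negP => ekl; have /andP[_ /mem_subseq/(_ k)] := h l ltac:(lia).
  rewrite mem_smaller ekl (ltn_trans kj jl) mem_filter => /(_ isT)/andP[/uncoveredP/(_ i j ik)].
  by rewrite kj jl eij => /(_ isT).
apply/andP; split.
  have [|i ij eij] := par j; first by lia.
  have : i \in smaller e j by rewrite mem_smaller ij.
  by case: (smaller e j).
have -> : smaller e j = [seq i <- visible e j | e i j].
  rewrite -filter_predI; apply: eq_in_filter => i; rewrite mem_rev mem_iota => /andP[_ ij] /=.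
  case: (boolP (e i j)) => //= eij; apply/esym/uncoveredP => a b ai ibj.
  by apply/negP => eab; have := nc a i b j; rewrite ai eij eab; case/andP: ibj => -> -> /=; lia.
exact: filter_subseq.
Qed.

Lemma codes_sorted n k st L : sorted gtn st -> all (ltn^~ k) st -> L \in codes n k st ->
  size L = n /\ forall t, t < n -> sorted gtn (nth [::] L t) /\ all (ltn^~ (k + t)) (nth [::] L t).
Proof.
elim: n k st L => [|n IH] k st L st_s st_k; first by rewrite inE => /eqP->.
move=> /allpairsPdep[T [L' [Tc Lc ->]]].
have [s1 s2] := next_stack_sorted T st_s st_k.
have [sL hL] := IH _ _ _ s1 s2 Lc; split=> /=; first by rewrite sL.
move=> [_|t tn] /=; last by rewrite addnS -addSn; apply: hL.
move: Tc; rewrite mem_choices => /andP[_ Ts]; split; first exact: subseq_sorted gtn_trans _ _ Ts st_s.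
rewrite addn0; apply/allP=> u uT; exact: (allP st_k) (mem_subseq Ts uT).
Qed.

Lemma codes_graph n L : L \in codes n 1 [:: 0] ->
  exists2 e, canonical n e & graph_code n e = L.
Proof.
move=> Lc; have [sL hL] := codes_sorted (k := 1) (st := [:: 0]) isT isT Lc.
(* The list at index 0 belongs to vertex 1, since vertex 0 has no smaller neighbours. *)
pose e : rel nat := fun i j => i \in nth [::] L j.-1.
have eL : graph_code n e = L.
  apply: (@eq_from_nth _ [::]) => [|t]; rewrite size_map size_iota => // tn.
  rewrite (nth_map 0) ?size_iota // nth_iota // add1n.
  have [s1 s2] := hL t tn.
  apply: (irr_sorted_eq gtn_trans ltnn) => // [|u].
    by exact: sorted_filter gtn_trans _ _ (rev_iota_sorted _).
  rewrite mem_smaller /e /= andbC; apply: andb_idr => /(allP s2); by rewrite add1n.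
by exists e => //; apply/mem_graph_code; rewrite eL.
Qed.
End GraphCodes.

(** * Counting coloured Dyck paths *)

Section BoundedWords.
Variable T : finType.
Implicit Types (P : pred (seq T)) (k : nat).

Definition count_words k P : nat := #|[set p : {bseq k of T} | P p]|.

Fixpoint words k : seq (seq T) :=
  if k is k'.+1 then [::] :: [seq t :: p | t <- enum T, p <- words k'] else [:: [::]].

Lemma mem_words k p : (p \in words k) = (size p <= k).
Proof.
elim: k p => [|k IH] [|t p] //=; rewrite inE /=.
apply/allpairsP/idP => [[[t' p'] /= [_ + [_ ->]]]|pk]; first by rewrite IH.
by exists (t, p); rewrite mem_enum IH.
Qed.

Lemma words_uniq k : uniq (words k).
Proof.
elim: k => //= k IH; apply/andP; split; first by apply/allpairsP=> -[[t p] /= []].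
by apply: allpairs_uniq; rewrite ?enum_uniq // => -[t p] [t' p'] _ _ /= [-> ->].
Qed.

Lemma count_wordsE k P : count_words k P = count P (words k).
Proof.
have : perm_eq [seq val p | p <- enum {: {bseq k of T}}] (words k).
  apply: uniq_perm; rewrite ?words_uniq ?(map_inj_uniq val_inj) ?enum_uniq // => p.
  rewrite mem_words; apply/mapP/idP => [[q _ ->]|pk]; first exact: size_bseq.
  by exists (Bseq pk); rewrite ?mem_enum.
move/seq.permP/(_ P) => <-; rewrite count_map -size_filter /count_words cardE.
rewrite /enum_mem -filter_predI; congr size; apply: eq_filter => p.
by rewrite !inE andbT.
Qed.

Lemma count_words0 P : count_words 0 P = P [::].
Proof. by rewrite count_wordsE /= addn0. Qed.

Lemma count_wordsS k P :
  count_words k.+1 P = P [::] + \sum_(t : T) count_words k (fun p => P (t :: p)).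
Proof.
rewrite count_wordsE /=; congr (_ + _).
rewrite -big_enum /=; elim: (enum T) => [|t s IH]; first by rewrite big_nil.
by rewrite big_cons allpairs_cons count_cat IH count_map count_wordsE.
Qed.

Lemma eq_count_words k P Q : P =1 Q -> count_words k P = count_words k Q.
Proof. by move=> PQ; rewrite !count_wordsE; apply: eq_count. Qed.

Lemma count_words_stable k k' P : (forall p, P p -> size p <= k) -> k <= k' ->
  count_words k' P = count_words k P.
Proof.
elim: k k' P => [|k IH] [|k'] P Pk // kk'.
  rewrite count_wordsS count_words0 big1 ?addn0 // => t _.
  rewrite count_wordsE; apply/eqP; rewrite -leqn0 leqNgt -has_count.
  by apply/hasP=> -[p _ /Pk].
rewrite !count_wordsS; congr (_ + _); apply: eq_bigr => t _.
by apply: IH => // p /Pk.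
Qed.
End BoundedWords.

(** Paths from [(0, d)] to [(r, r)]; [schroder 0] unfolds to [little_schroder], and a free starting
    height permits a recurrence on the first step. *)
Definition schroder (d r : nat) : nat := count_words r.*2 (schroder_path r 0 d).

Lemma schroder_path_shift m x y p :
  schroder_path m.+1 x.+1 y.+1 p = schroder_path m x y p.
Proof. by elim: p x y => [|[] p IH] x y //=; rewrite ?IH ?ltnS. Qed.

Lemma schroder_path_size m x y p : schroder_path m x y p -> size p + x + y <= m.*2.
Proof.
elim: p x y => [|[] p IH] x y /=; first by move=> /andP[/eqP-> /eqP->]; lia.
- by move=> /andP[_ /IH]; lia.
- by move=> /IH; lia.
- by move=> /andP[_ /IH]; lia.
Qed.

Lemma schroder_fuel k d r : r.*2 <= k + d ->
  count_words k (schroder_path r 0 d) = schroder d r.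
Proof.
move=> kr; have b p : schroder_path r 0 d p -> size p <= r.*2 - d.
  by move=> /schroder_path_size; lia.
by rewrite /schroder !(count_words_stable b); lia.
Qed.

Lemma schroder_gt d r : r < d -> schroder d r = 0.
Proof.
move=> rd; rewrite /schroder count_wordsE; apply/eqP; rewrite -leqn0 leqNgt -has_count.
apply/hasP=> -[p _]; move: rd; rewrite -[X in X < d]addn0 => rd.
suff H x y : r < y -> ~~ schroder_path r x y p by apply/negP/H; lia.
elim: p x y {rd} => [|[] p IH] x y ry /=; rewrite ?negb_and.
- by rewrite (gtn_eqF ry) orbT.
- by rewrite IH ?orbT.
- by rewrite IH // ltnW.
- by rewrite IH ?orbT // ltnW.
Qed.

Lemma big_schroder_step (F : schroder_step -> nat) :
  \sum_t F t = F East + F North + F Diagonal.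
Proof.
have pe : perm_eq (index_enum schroder_step) [:: East; North; Diagonal].
  by apply: uniq_perm; rewrite ?index_enum_uniq // => -[]; rewrite mem_index_enum.
by rewrite (perm_big _ pe) /= !big_cons big_nil addn0 addnA.
Qed.

Lemma schroder0 r : schroder 0 r = (r == 0) + schroder 1 r.
Proof.
case: r => [|r]; first by rewrite (schroder_gt (d := 1)) // /schroder count_words0.
rewrite {1}/schroder doubleS count_wordsS big_schroder_step /= add0n.
rewrite (schroder_fuel (d := 1)); last by lia.
have -> : count_words r.*2.+1 (fun=> false) = 0 :> nat.
  by move=> T; rewrite count_wordsE count_pred0.
by rewrite add0n addn0.
Qed.

(** The summands belong to a first step North, East and Diagonal; after the last two the origin is
    moved to [(1, 1)]. *)
Lemma schroderS d r : 0 < r -> schroder d.+1 r =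
  schroder d.+2 r + (schroder d r.-1 + schroder d.+1 r.-1).
Proof.
case: r => // r _; rewrite -(schroder_fuel (k := r.*2.+1)) ?count_wordsS; last by lia.
rewrite big_schroder_step /= add0n.
under eq_count_words do rewrite schroder_path_shift.
under [X in _ + X]eq_count_words do rewrite schroder_path_shift.
by rewrite !schroder_fuel /=; lia.
Qed.

(* [dyck_count k n h] is the total weight of the sequences of at most [k]     *)
(* pieces from height [h] to height 0 whose ascents have total length [2n],   *)
(* an ascent of length [2j] having weight [s_(j-1)].                          *)
Fixpoint dyck_count (k n h : nat) : nat :=
  if k is k'.+1 then
    (if h is h'.+1 then dyck_count k' n h' else n == 0) +
    \sum_(j < n) little_schroder j * dyck_count k' (n - j.+1) (h + j.+1)
  else (n == 0) && (h == 0).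

Fixpoint piece_words (k n h : nat) : seq (seq nat) :=
  if k is k'.+1 then
    (if h is h'.+1 then [seq 0 :: w | w <- piece_words k' n h']
     else if n == 0 then [:: [::]] else [::]) ++
    [seq j.+1 :: w | j <- iota 0 n, w <- piece_words k' (n - j.+1) (h + j.+1)]
  else if (n == 0) && (h == 0) then [:: [::]] else [::].

(** Inside a piece [j.+1] the path never falls below its starting height, so only the heights
    between pieces need to be watched. *)
Fixpoint balanced (h : nat) (w : seq nat) : bool :=
  match w with
  | [::] => h == 0
  | 0 :: w' => (0 < h) && balanced h.-1 w'
  | j.+1 :: w' => balanced (h + j.+1) w'
  end.

Definition piece_weight (w : seq nat) : nat :=
  \prod_(j <- w | 0 < j) little_schroder j.-1.

Definition piece_word_path (w : seq nat) : seq bool := flatten [seq dyck_piece j | j <- w].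

Lemma piece_word_pathS j w :
  piece_word_path (j.+1 :: w) = nseq j.+1.*2 true ++ nseq j.+1 false ++ piece_word_path w.
Proof. by rewrite catA. Qed.

Lemma dyck_countE k n h : dyck_count k n h = \sum_(w <- piece_words k n h) piece_weight w.
Proof.
elim: k n h => [|k IH] n h /=.
  by case: (_ && _); rewrite ?big_seq1 ?big_nil // /piece_weight big_nil.
rewrite big_cat /=; congr (_ + _).
  case: h => [|h]; last first.
    by rewrite big_map IH; apply: eq_bigr => w _; rewrite /piece_weight big_cons.
  by case: (n == 0); rewrite ?big_seq1 ?big_nil // /piece_weight big_nil.
rewrite big_allpairs_dep -(big_mkord predT (fun j =>
  little_schroder j * dyck_count k (n - j.+1) (h + j.+1))) /index_iota subn0.
apply: eq_bigr => j _; rewrite IH big_distrr; apply: eq_bigr => w _.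
by rewrite /piece_weight big_cons.
Qed.

(** Every piece strictly decreases [n.*2 + h], which therefore bounds the number of pieces. *)
Lemma dyck_count_fuel k k' n h : n.*2 + h <= k -> n.*2 + h <= k' ->
  dyck_count k n h = dyck_count k' n h.
Proof.
have zero k0 : dyck_count k0 0 0 = 1 by case: k0 => //= k0; rewrite big_ord0.
elim: k k' n h => [|k IH] k' n h kn k'n.
  by have [-> ->] : n = 0 /\ h = 0 by lia; rewrite !zero.
case: k' k'n => [|k'] k'n; first by have [-> ->] : n = 0 /\ h = 0 by lia; rewrite !zero.
rewrite /=; congr (_ + _); first by case: h kn k'n => // h kn k'n; apply: IH; lia.
apply: eq_bigr => -[j jn] _ /=; congr (_ * _); apply: IH; lia.
Qed.

Lemma mem_piece_words k n h w : n.*2 + h <= k ->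
  (w \in piece_words k n h) = balanced h w && (sumn w == n).
Proof.
elim: k n h w => [|k IH] n h w kn.
  have [-> ->] : n = 0 /\ h = 0 by lia.
  rewrite /= inE; case: w => [|[|j] w] //=.
  by rewrite addSn andbF.
rewrite /= mem_cat; case: w => [|[|j] w].
- have -> : ([::] \in [seq j.+1 :: w | j <- iota 0 n,
      w <- piece_words k (n - j.+1) (h + j.+1)]) = false.
    by apply/negP => /allpairsPdep[j [w [_ _]]].
  rewrite orbF /= (eq_sym 0); case: h {kn} => [|h]; first by case: (n == 0).
  by apply/negP => /mapP[].
- have -> : (0 :: w \in [seq j.+1 :: w | j <- iota 0 n,
      w <- piece_words k (n - j.+1) (h + j.+1)]) = false.
    by apply/negP => /allpairsPdep[j [u [_ _]]].
  rewrite orbF /= add0n; case: h kn => [|h] kn; first by case: (n == 0).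
  by rewrite mem_map ?IH; [|lia|move=> ? ? []].
- set L := (if h is _.+1 then _ else _).
  have -> : (j.+1 :: w \in L) = false.
    rewrite /L; case: h {kn L} => [|h]; first by case: (n == 0).
    by apply/negP => /mapP[].
  rewrite /=; apply/allpairsPdep/andP => [[j' [w' [jn ww [-> ->]]]]|[bw /eqP wn]].
    move: jn ww; rewrite mem_iota add0n => jn; rewrite IH; last by lia.
    by move=> /andP[-> /eqP ww]; split=> //; apply/eqP; rewrite ww; lia.
  exists j, w; rewrite mem_iota IH; last by lia.
  by split=> //; [lia|rewrite bw; apply/eqP; lia].
Qed.

Lemma piece_words_uniq k n h : uniq (piece_words k n h).
Proof.
elim: k n h => [|k IH] n h /=; first by case: (_ && _).
rewrite cat_uniq; apply/and3P; split.
- by case: h => [|h]; [case: (n == 0)|rewrite map_inj_uniq ?IH // => ? ? []].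
- apply/hasPn=> w /allpairsPdep[j [u [_ _ ->]]]; case: h => [|h]; first by case: (n == 0).
  by apply/negP => /mapP[].
- apply: allpairs_uniq_dep; rewrite ?iota_uniq // => -[j w] [j' w'] _ _ /= [e1 e2].
  by case: _ / e1 e2 => ->.
Qed.

Lemma ascents_from_up k m p : ascents_from k (nseq m true ++ p) = ascents_from (k + m) p.
Proof. by elim: m k => [|m IH] k; rewrite ?addn0 //= IH addnS. Qed.

Lemma ascents_from_down m p : ascents_from 0 (nseq m false ++ p) = ascents_from 0 p.
Proof. by elim: m. Qed.

Lemma ascents_piece_word w :
  ascents (piece_word_path w) = [seq j.*2 | j <- w & 0 < j].
Proof.
rewrite /ascents; elim: w => // -[|j] w IH; first by rewrite /= -IH.
by rewrite piece_word_pathS ascents_from_up /= ascents_from_down IH.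
Qed.

Fixpoint dyck_from (h : nat) (p : seq bool) : bool :=
  match p with
  | [::] => h == 0
  | true :: p' => dyck_from h.+1 p'
  | false :: p' => (0 < h) && dyck_from h.-1 p'
  end.

Definition ups (p : seq bool) : nat := count_mem true p.

Definition downs (p : seq bool) : nat := count_mem false p.

Arguments ups : simpl never.
Arguments downs : simpl never.

Lemma ups_cons b p : ups (b :: p) = b + ups p. Proof. by case: b. Qed.

Lemma downs_cons b p : downs (b :: p) = ~~ b + downs p. Proof. by case: b. Qed.

Lemma dyck_fromP h p : reflect
  (ups p + h = downs p /\ forall k, downs (take k p) <= ups (take k p) + h)
  (dyck_from h p).
Proof.
elim: p h => [|[] p IH] h /=; first by apply: (iffP eqP) => [->|[]].
- rewrite ups_cons downs_cons; apply: (iffP (IH h.+1)) => -[e le]; split; try lia.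
  + by case=> [|k] //=; rewrite ups_cons downs_cons; have := le k; lia.
  + by move=> k; have := le k.+1; rewrite /= ups_cons downs_cons; lia.
- rewrite ups_cons downs_cons; apply: (iffP andP) => [[h0 /IH[e le]]|[e le]].
    by split=> [|[|k]] //=; [lia|rewrite ups_cons downs_cons; have := le k; lia].
  have h0 : 0 < h by have := le 1; rewrite /= take0; apply.
  split=> //; apply/IH; split=> [|k]; first by lia.
  by have := le k.+1; rewrite /= ups_cons downs_cons; lia.
Qed.

Lemma is_dyckE p : is_dyck p = dyck_from 0 p.
Proof.
rewrite /is_dyck -/(ups p) -/(downs p).
apply/andP/dyck_fromP => [[/eqP e /forallP le]|[e le]]; last first.
  split; first by rewrite -e addn0.
  by apply/forallP=> k; have := le k; rewrite addn0.
split=> [|k]; first by rewrite addn0.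
rewrite addn0; have [kp|pk] := leqP k (size p); first exact: (le (Ordinal (kp : k < (size p).+1))).
by rewrite take_oversize ?e // ltnW.
Qed.

Lemma dyck_from_up h m p : dyck_from h (nseq m true ++ p) = dyck_from (h + m) p.
Proof. by elim: m h => [|m IH] h; rewrite ?addn0 //= IH addnS. Qed.

Lemma dyck_from_down h m p : dyck_from (h + m) (nseq m false ++ p) = dyck_from h p.
Proof. by elim: m => [|m IH]; rewrite ?addn0 // addnS /= IH. Qed.

Lemma dyck_from_piece_word h w : dyck_from h (piece_word_path w) = balanced h w.
Proof.
elim: w h => // -[|j] w IH h; first by rewrite /= -IH.
by rewrite piece_word_pathS dyck_from_up -addnn addnA dyck_from_down IH.
Qed.

Lemma size_piece_word w :
  size (piece_word_path w) = count_mem 0 w + 3 * sumn w.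
Proof.
elim: w => // -[|j] w IH; first by rewrite /= -/(piece_word_path w) IH.
by rewrite piece_word_pathS !size_cat !size_nseq IH /=; lia.
Qed.

Lemma balanced_count h w : balanced h w -> h + sumn w = count_mem 0 w.
Proof. by elim: w h => [|[|j] w IH] h /=; [move/eqP->|move=> /andP[h0 /IH <-]|move=> /IH <-]; lia. Qed.

(** The position of the first down-step is twice the index of the first piece, so the pieces can be
    read off one by one. *)
Lemma piece_word_path_inj : injective piece_word_path.
Proof.
have nil j w : piece_word_path (j :: w) <> [::] by case: j.
have idx j w : index false (piece_word_path (j :: w)) = j.*2.
  by case: j => // j; rewrite piece_word_pathS; elim: (j.+1.*2) => //= m ->.
elim=> [|j w IH] [|j' w'] // e; [by case: (nil j' w')|by case: (nil j w)|].
have jj : j = j' by apply: double_inj; rewrite -(idx j w) e idx.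
move: e; rewrite -jj /piece_word_path /= => /eqP; rewrite eqseq_cat // eqxx /= => /eqP.
by move/IH ->.
Qed.

Lemma concatenationP n p : reflect
  (exists2 w, all (fun j => j <= n) w & p = piece_word_path w) (is_concatenation_of_pieces n p).
Proof.
apply: (iffP existsP) => [[w /eqP ->]|[w wn pE]].
  exists [seq val j | j <- w]; last by rewrite /piece_word_path -map_comp.
  by apply/allP=> _ /mapP[j _ ->]; rewrite /= -ltnS.
pose u : seq 'I_n.+1 := [seq inord j | j <- w].
have uE : [seq val j | j <- u] = w.
  by rewrite -map_comp map_id_in // => j jw /=; rewrite inordK // ltnS (allP wn).
have su : size u <= size p.
  rewrite pE size_map /piece_word_path; elim: (w) => //= j s IH.
  by rewrite size_cat -add1n leq_add //; case: j.
by exists (Bseq su); apply/eqP; rewrite [LHS]pE -uE /piece_word_path -map_comp.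
Qed.

(** A piece [j > 0] has [3 * j] steps and raises the height by [j], so a balanced word [w] has
    [sumn w] single down-steps and its path has length [4 * sumn w]. *)
Lemma mem_dyck_path n (p : seq bool) :
  [&& size p == 4 * n, is_dyck p & is_concatenation_of_pieces n p] =
  (p \in [seq piece_word_path w | w <- piece_words n.*2 n 0]).
Proof.
apply/and3P/mapP => [[/eqP sp dp /concatenationP[w wn pE]]|[w + ->]].
  exists w => //; rewrite mem_piece_words ?addn0 // -dyck_from_piece_word -pE -is_dyckE dp /=.
  have := size_piece_word w; rewrite -pE sp.
  have /balanced_count : balanced 0 w by rewrite -dyck_from_piece_word -pE -is_dyckE.
  by move=> <- ?; apply/eqP; lia.
rewrite mem_piece_words ?addn0 // => /andP[bw /eqP wn]; split.
- by rewrite size_piece_word -(balanced_count bw) wn; apply/eqP; lia.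
- by rewrite is_dyckE dyck_from_piece_word.
- apply/concatenationP; exists w => //; rewrite -wn; elim: (w) => //= j u IH.
  rewrite leq_addr /=; apply: sub_all IH => i; lia.
Qed.

Lemma card_colouring (p : seq bool) :
  #|{: colouring p}| = \prod_(l <- ascents p) little_schroder l./2.-1.
Proof.
rewrite card_dep_ffun foldrE big_map; rewrite (big_nth 0) big_mkord.
by rewrite -big_enum /= ; apply: eq_bigr => i _; rewrite card_ord.
Qed.

Lemma card_coloured_dyck_path n :
  #|{: coloured_dyck_path n}| = dyck_count n.*2 n 0.
Proof.
rewrite card_tagged sumnE big_map dyck_countE.
transitivity (\sum_(p <- [seq tval (val p) | p <- enum {: dyck_path n}])
                \prod_(l <- ascents p) little_schroder l./2.-1).
  by rewrite big_map; apply: eq_bigr => p _; rewrite card_colouring.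
have pe : perm_eq [seq tval (val p) | p <- enum {: dyck_path n}]
                  [seq piece_word_path w | w <- piece_words n.*2 n 0].
  apply: uniq_perm.
  - by rewrite map_inj_uniq ?enum_uniq //; apply: inj_comp val_inj val_inj.
  - by rewrite (map_inj_uniq piece_word_path_inj) piece_words_uniq.
  move=> p; rewrite -mem_dyck_path; apply/mapP/and3P => [[q _ ->]|[sp dp cp]].
    by rewrite size_tuple; case/andP: (valP q).
  have qP : is_dyck (Tuple sp) && is_concatenation_of_pieces n (Tuple sp) by rewrite /= dp.
  by exists (Sub (Tuple sp) qP); rewrite ?mem_enum ?SubK.
rewrite (perm_big _ pe) big_map; apply: eq_bigr => w _.
rewrite ascents_piece_word big_map big_filter; apply: eq_bigr => j _.
by rewrite doubleK.
Qed.

(** * The common generating series *)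

Section NilpotentSeries.
Import GRing.Theory.
Local Open Scope ring_scope.
Variables (R : comNzRingType) (N : nat).

Definition multiple_of_power (z : R) k a := exists b, a = z ^+ k * b.

(** A truncated generating series, evaluated at a nilpotent [z]; keeping [z] arbitrary allows the
    substitution of [z * d] in the Schröder series. *)
Definition series (z : R) (f : nat -> nat) : R := \sum_(n < N) (f n)%:R * z ^+ n.

Lemma eq_series z f g : f =1 g -> series z f = series z g.
Proof. by move=> fg; apply: eq_bigr => n _; rewrite fg. Qed.

Lemma seriesD z f g : series z (fun n => f n + g n)%N = series z f + series z g.
Proof. by rewrite -big_split; apply: eq_bigr => n _ /=; rewrite natrD mulrDl. Qed.

Lemma seriesMl z c f : series z (fun n => c * f n)%N = c%:R * series z f.
Proof. by rewrite big_distrr; apply: eq_bigr => n _ /=; rewrite natrM mulrA. Qed.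

Lemma series_0 z f : f =1 (fun=> 0%N) -> series z f = 0.
Proof. by move=> f0; apply: big1 => n _; rewrite f0 mul0r. Qed.

Lemma series_shift z f : z ^+ N = 0 ->
  series z f = (if N is 0 then 0 else (f 0)%:R) + z * series z (fun n => f n.+1).
Proof.
rewrite /series; case: N => [|M] zN; first by rewrite !big_ord0 mulr0 addr0.
rewrite big_ord_recl mulr1; congr (_ + _).
rewrite big_ord_recr mulrDr mulrCA -exprS zN mulr0 addr0 big_distrr.
by apply: eq_bigr => i _; rewrite /bump /= exprS mulrCA.
Qed.

Section Closure.
Variable z : R.
Local Notation mult k := (multiple_of_power z k).

Lemma mult0 k : mult k 0. Proof. by exists 0; rewrite mulr0. Qed.

Lemma mult_exp0 a : mult 0 a. Proof. by exists a; rewrite mul1r. Qed.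

Lemma multD k a b : mult k a -> mult k b -> mult k (a + b).
Proof. by move=> [c ->] [d ->]; exists (c + d); rewrite mulrDr. Qed.

Lemma multMl k a b : mult k b -> mult k (a * b).
Proof. by move=> [c ->]; exists (a * c); rewrite mulrCA. Qed.

Lemma multS k a : mult k a -> mult k.+1 (z * a).
Proof. by move=> [c ->]; exists c; rewrite exprS mulrA. Qed.

Lemma mult_sum k (I : finType) (F : I -> R) :
  (forall i, mult k (F i)) -> mult k (\sum_i F i).
Proof. by move=> h; elim/big_ind: _ => [|x y|i _] //; [exact: mult0|exact: multD]. Qed.
End Closure.

(** Consecutive iterates of [f] from 0 differ by multiples of growing powers of [z], hence agree
    after [N] steps. *)
Lemma nilpotent_fixpoint z (f : R -> R) : z ^+ N = 0 ->
  (forall x y, exists c, f x - f y = z * c * (x - y)) -> exists x, f x = x.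
Proof.
move=> zN contr; pose u k := iter k f 0.
have uM k : multiple_of_power z k (u k.+1 - u k).
  elim: k => [|k [b ub]]; first exact: mult_exp0.
  have [c uc] := contr (u k.+1) (u k); exists (c * b).
  by rewrite [LHS]uc ub exprS; ring.
exists (u N); have [b ub] := uM N.
by apply/eqP; rewrite -subr_eq0 -[f _]/(u N.+1) ub zN mul0r.
Qed.
End NilpotentSeries.

(** * Solving the recurrences with truncated series *)

Section Counting.
Import GRing.Theory.
Local Open Scope ring_scope.
Variables (R : comNzRingType) (N0 : nat) (z : R).
Let N := N0.+1.
Hypothesis zN : z ^+ N = 0.
Local Notation ser := (series N).
Local Notation mult k := (multiple_of_power z k).

Lemma mult_zero a : (forall k, mult k a) -> a = 0.
Proof. by move/(_ N) => [b ->]; rewrite zN mul0r. Qed.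

(* [1 - e = 1 / u] and [e = e ^+ 2 + z * d ^+ 2] is the algebraic equation of *)
(* the generating series of nonempty simple outerplanar maps.                 *)
Lemma outerplanar_series : exists u v e d : R,
  [/\ v * (1 + z) = 1, u = 1 + z * (2%:R * u - 1) ^+ 2, d = 1 + e,
      d = v * (1 + z * (4%:R * u - 2%:R)) & [/\ u = 1 + e * u, e = z * d ^+ 2 * u & e = e ^+ 2 + z * d ^+ 2]].
Proof.
have [u uE] : exists u : R, 1 + z * (2%:R * u - 1) ^+ 2 = u.
  (* The witness comes from [(2x - 1)^2 - (2y - 1)^2 = 4(x + y - 1)(x - y)]. *)
  apply: (nilpotent_fixpoint zN) => x y; exists (4%:R * (x + y - 1)); ring.
have [v vE] : exists v : R, 1 - z * v = v.
  by apply: (nilpotent_fixpoint zN) => x y; exists (- 1); ring.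
have v1 : v * (1 + z) = 1 by rewrite -[RHS](subrK (z * v)) vE; ring.
pose d := v * (1 + z * (4%:R * u - 2%:R)); pose e := d - 1.
have ud : u * d = 2%:R * u - 1.
  have -> : u * d = v * (u + 4%:R * (z * u ^+ 2) - 2%:R * z * u) by rewrite /d; ring.
  have zu : 4%:R * (z * u ^+ 2) = u - 1 + 4%:R * z * u - z by rewrite -[X in X - 1]uE; ring.
  by rewrite zu; transitivity (v * (1 + z) * (2%:R * u - 1)); [ring|rewrite v1 mul1r].
have ue : u * (1 - e) = 1.
  have -> : u * (1 - e) = 2%:R * u - u * d by rewrite /e; ring.
  by rewrite ud; ring.
have eE : e = z * d ^+ 2 * u.
  have h : e * u = z * (u * d) ^+ 2.
    rewrite ud; have -> : e * u = u - u * (1 - e) by ring.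
    by rewrite ue -[X in X - 1]uE; ring.
  have -> : e = e * u * (1 - e) by rewrite -mulrA ue mulr1.
  rewrite h; have -> : z * (u * d) ^+ 2 * (1 - e) = z * d ^+ 2 * u * (u * (1 - e)) by ring.
  by rewrite ue mulr1.
exists u, v, e, d; split=> //; first by rewrite /e; ring.
split=> //; first by rewrite -[LHS](subrK (e * u)) -{1}[u]mul1r -mulrBl mulrC ue.
have -> : z * d ^+ 2 = e * (1 - e); last by ring.
have -> : z * d ^+ 2 = z * d ^+ 2 * u * (1 - e) by rewrite -mulrA ue mulr1.
by rewrite -eE.
Qed.

(** The recurrence is [b h.+1 = 1 + z * b h.+2 + 2 * b h] with [b 0 = 0]. It has the constant
    solution [- v], and its homogeneous part has the solution [l ^+ h] for [l = 2 + z * l ^+ 2];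
    hence [b h = v * (l ^+ h - 1)]. *)
Lemma outerplanar_graph_series v u :
    v * (1 + z) = 1 -> u = 1 + z * (2%:R * u - 1) ^+ 2 ->
  ser z (graph_count ^~ 1%N) = v * (1 + z * (4%:R * u - 2%:R)).
Proof.
move=> v1 uE; set l := _ - 2%:R.
have lE : l = 2%:R + z * l ^+ 2.
  have -> : z * l ^+ 2 = 4%:R * (z * (2%:R * u - 1) ^+ 2) by rewrite /l; ring.
  have -> : z * (2%:R * u - 1) ^+ 2 = u - 1 by rewrite [in RHS]uE; ring.
  by rewrite /l; ring.
pose b h := ser z (fun n => graph_count n.+1 h).
have gE h : ser z (graph_count ^~ h) = 1 + z * b h by rewrite (series_shift _ zN).
pose delta h := b h - v * (l ^+ h - 1).
have d0 : delta 0%N = 0.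
  by rewrite /delta /b series_0 => [|n]; rewrite ?graph_countS0 // expr0; ring.
have dS h : delta h.+1 = z * delta h.+2 + 2%:R * delta h.
  have -> : delta h.+1 = ser z (graph_count ^~ h.+2) + 2%:R * b h - v * (l ^+ h.+1 - 1).
    by rewrite /delta /b -seriesMl -seriesD; congr (_ - _); apply: eq_series => n.
  have -> : l ^+ h.+1 = l ^+ h * 2%:R + z * l ^+ h.+2.
    by rewrite exprSr [X in _ * X = _]lE !exprS; ring.
  rewrite gE /delta; have -> : v * (l ^+ h * 2%:R + z * l ^+ h.+2 - 1) =
    v * (1 + z) - z * v - 2%:R * v + z * v * l ^+ h.+2 + 2%:R * v * l ^+ h by ring.
  by rewrite v1; ring.
(* The term with [z] gains a power by the outer induction; the term [2 * delta h] does not, and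
   needs the inner induction on [h]. *)
have dk k : forall h, mult k (delta h).
  elim: k => [|k IH] h; first exact: mult_exp0.
  elim: h => [|h IHh]; first by rewrite d0; apply: mult0.
  by rewrite dS; apply: multD; [apply: multS|apply: multMl].
have b1 : b 1%N = v * (l - 1).
  by apply/eqP; rewrite -subr_eq0 -[l in l - 1]expr1; apply/eqP/mult_zero => k; apply: dk.
by rewrite gE b1; transitivity (v * (1 + z) + z * (v * (l - 1))); [rewrite v1|ring].
Qed.

(** The equation for [e] says that its powers satisfy the recurrence [schroderS], and
    [u = 1 + e * u] matches the boundary [schroder0]. Both sides vanish for [d >= N]. *)
Lemma schroder_series u e y : y ^+ N = 0 -> e ^+ N = 0 ->
    (exists c, y = z * c) -> u = 1 + e * u -> e = e ^+ 2 + y * (1 + e) ->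
  forall d, ser y (schroder d) = e ^+ d * u.
Proof.
move=> yN eN [c yc] uE eE d.
pose delta d := ser y (schroder d) - e ^+ d * u.
have d0 : delta 0%N = delta 1%N.
  rewrite /delta [in LHS](_ : ser y (schroder 0) = 1 + ser y (schroder 1)).
    by rewrite [in LHS]expr0 mul1r [in LHS]uE; ring.
  rewrite -[1](_ : ser y (fun n => (n == 0)%N) = 1); last first.
    by rewrite (series_shift _ yN) series_0 // mulr0 addr0.
  by rewrite -seriesD; apply: eq_series => n; rewrite schroder0.
have dS k : delta k.+1 = delta k.+2 + y * (delta k + delta k.+1).
  have serS : ser y (schroder k.+1) =
      ser y (schroder k.+2) + y * (ser y (schroder k) + ser y (schroder k.+1)).
    rewrite -seriesD (series_shift (schroder k.+1) yN) (series_shift (schroder k.+2) yN).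
    rewrite !schroder_gt // !add0r -mulrDr -seriesD; congr (_ * _).
    by apply: eq_series => n; rewrite schroderS.
  have eS : e ^+ k.+1 = e ^+ k.+2 + y * (e ^+ k + e ^+ k.+1).
    by rewrite exprSr [X in _ * X = _]eE !exprS; ring.
  by rewrite /delta [in LHS]serS [in LHS]eS; ring.
have big j : (N <= j)%N -> delta j = 0.
  move=> Nj; rewrite /delta /series big1 => [|i _].
    by rewrite -(subnKC Nj) exprD eN; ring.
  by rewrite schroder_gt ?mul0r // (leq_trans (ltn_ord i)).
have dk k : forall j, mult k (delta j).
  elim: k => [|k IH] j; first exact: mult_exp0.
  (* Descending induction on [j], since [dS] expresses [delta j] by [delta j.+1] up to a multiple of
     [y]. *)
  have [m] := ubnP (N - j); elim: m j => // m IHm j jm.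
  have [Nj|jN] := leqP N j; first by rewrite big //; apply: mult0.
  have next : mult k.+1 (delta j.+1) by apply: IHm; lia.
  case: j jm jN next => [|j] jm jN next; first by rewrite d0.
  by rewrite dS yc -mulrA; apply: multD => //; apply/multS/multMl/multD.
by apply/eqP; rewrite -subr_eq0; apply/eqP/mult_zero => k; apply: dk.
Qed.

(** Each shift detaches the term [j = 0] and a factor [z] from the rest; after [N] shifts the rest
    is killed. *)
Lemma series_convolution (s : nat -> nat) (f : nat -> nat -> nat) :
  ser z (fun n => \sum_(j < n) s j * f j (n - j.+1))%N =
  \sum_(j < N) (s j)%:R * z ^+ j.+1 * ser z (f j).
Proof.
suff H K (s' : nat -> nat) (f' : nat -> nat -> nat) : ser z (fun n => \sum_(j < n) s' j * f' j (n - j.+1))%N =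
    \sum_(j < K) (s' j)%:R * z ^+ j.+1 * ser z (f' j) +
    z ^+ K * ser z (fun n => \sum_(j < n) s' (j + K) * f' (j + K) (n - j.+1))%N.
  by rewrite (H N) zN mul0r addr0.
elim: K s' f' => [|K IH] {}s {}f.
  rewrite big_ord0 expr0 add0r mul1r; apply: eq_series => n.
  by apply: eq_bigr => j _; rewrite addn0.
rewrite (series_shift _ zN) big_ord0 add0r.
rewrite (@eq_series _ _ z _ (fun n => (s 0 * f 0 n + \sum_(j < n) s j.+1 * f j.+1 (n - j.+1))%N)).
  rewrite seriesD seriesMl (IH (fun j => s j.+1) (fun j => f j.+1)).
  rewrite big_ord_recl /= !mulrDr -!addrA expr1 mulrCA mulrA; congr (_ + _).
  rewrite mulrA -exprS; congr (_ + _ * _).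
    by rewrite big_distrr /=; apply: eq_bigr => j _; rewrite /bump /= !exprS; ring.
  by apply: eq_series => n; apply: eq_bigr => j _; rewrite -!addnS.
by move=> n; rewrite big_ord_recl subn1 /=; congr (_ + _)%N.
Qed.

(** Starting at height [h], the series is [d ^+ h.+1]: a path splits at its first passages below
    [h], ..., [1] into [h.+1] factors. In the recurrence the ascents then contribute
    [d ^+ h * (z * d ^+ 2 * u) = d ^+ h * e], where [u] is the Schröder series at [z * d]. *)
Lemma dyck_series u e d : d = 1 + e -> u = 1 + e * u -> e = z * d ^+ 2 * u ->
  e = e ^+ 2 + z * d ^+ 2 ->
  ser z (fun n => dyck_count n.*2 n 0) = d.
Proof.
move=> dE uE eE eE'.
pose w h := ser z (fun n => dyck_count (n.*2 + h) n h).
pose steps h := \sum_(j < N) (little_schroder j)%:R * z ^+ j.+1 * w (h + j.+1)%N.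
have wE h : w h = (if h is h'.+1 then w h' else 1) + steps h.
  have -> : steps h = ser z (fun n => \sum_(j < n) little_schroder j *
      dyck_count ((n - j.+1).*2 + (h + j.+1)) (n - j.+1) (h + j.+1))%N.
    exact: esym (series_convolution little_schroder
      (fun j m => dyck_count (m.*2 + (h + j.+1)) m (h + j.+1)))%N.
  have dyckS n h' : dyck_count (n.*2 + h') n h' = ((if h' is h''.+1 then
      dyck_count (n.*2 + h'') n h'' else n == 0) + \sum_(j < n) little_schroder j *
      dyck_count ((n - j.+1).*2 + (h' + j.+1)) (n - j.+1) (h' + j.+1))%N.
    rewrite (@dyck_count_fuel _ (n.*2 + h').+1) //=; congr (_ + _)%N.
      by case: h' => // h'; apply: dyck_count_fuel; lia.
    apply: eq_bigr => -[j jn] _ /=; congr (_ * _)%N; apply: dyck_count_fuel; lia.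
  rewrite /w (@eq_series _ _ z _ _ (fun n => dyckS n h)) seriesD; congr (_ + _).
  by case: h {dyckS} => //; rewrite (series_shift _ zN) series_0 // mulr0 addr0.
have zdN : (z * d) ^+ N = 0 by rewrite exprMn zN mul0r.
have eN : e ^+ N = 0 by rewrite eE -mulrA exprMn zN mul0r.
have su : ser (z * d) (schroder 0) = u.
  rewrite (@schroder_series u e) ?expr0 ?mul1r //; first by exists d.
  by rewrite [LHS]eE' -dE; ring.
pose delta h := w h - d ^+ h.+1.
have stepsd h : \sum_(j < N) (little_schroder j)%:R * z ^+ j.+1 * d ^+ (h + j.+1).+1 = d ^+ h * e.
  have -> : d ^+ h * e = z * d ^+ h.+2 * ser (z * d) (schroder 0).
    by rewrite su [in LHS]eE !exprS; ring.
  rewrite big_distrr; apply: eq_bigr => j _ /=.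
  by rewrite addnS -2!addSn exprD exprMn exprS; ring.
have deltaE h : delta h = (if h is h'.+1 then delta h' else 0) +
    \sum_(j < N) (little_schroder j)%:R * z ^+ j.+1 * delta (h + j.+1)%N.
  have -> : \sum_(j < N) (little_schroder j)%:R * z ^+ j.+1 * delta (h + j.+1)%N =
      steps h - d ^+ h * e.
    by rewrite -stepsd -sumrB; apply: eq_bigr => j _; rewrite mulrBr.
  rewrite {1}/delta wE; case: h => [|h]; first by rewrite expr0 expr1 {1}dE; ring.
  by rewrite /delta [d ^+ h.+2]exprSr [X in _ - _ * X = _]dE; ring.
have dk k : forall h, mult k (delta h).
  elim: k => [|k IH] h; first exact: mult_exp0.
  have term i (j : 'I_N) :
      mult k.+1 ((little_schroder j)%:R * z ^+ j.+1 * delta (i + j.+1)%N).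
    have -> x y : x * z ^+ j.+1 * y = z * (x * z ^+ j * y) by rewrite exprS; ring.
    exact/multS/multMl.
  elim: h => [|h IHh]; rewrite deltaE; apply: multD => //; try exact: mult_sum.
  exact: mult0.
have -> : d = d ^+ 1 by rewrite expr1.
apply/eqP; rewrite -subr_eq0; apply/eqP/mult_zero => k.
by have := dk k 0%N; rewrite /delta /w; under eq_series do rewrite addn0.
Qed.
End Counting.

Section CountingInt.
Import GRing.Theory.
Local Open Scope ring_scope.

Lemma graph_dyck_count n : graph_count n 1 = dyck_count n.*2 n 0.
Proof.
(* Modulo ['X^n.+1] the coefficient of degree [n] is still visible. *)
pose N := n.+1; pose R := {poly %/ ('X^N : {poly int})}; pose z : R := 'qX.
have zN : z ^+ N = 0.
  rewrite /z /qpolyX -rmorphXn /=; apply: val_inj => /=.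
  by rewrite mk_monic_Xn Pdiv.RingMonic.rmodpp ?monicXn.
have coef f i : (i < N)%N -> (series N z f : {poly int})`_i = (f i)%:R.
  move=> iN; have -> : series N z f = in_qpoly 'X^N (\sum_(j < N) (f j)%:R * 'X^j).
    by rewrite rmorph_sum; apply: eq_bigr => j _; rewrite rmorphM rmorph_nat rmorphXn.
  rewrite in_qpoly_small; last first.
    rewrite mk_monic_Xn size_polyXn ltnS (leq_trans (size_sum _ _ _)) //.
    apply/bigmax_leqP => j _; rewrite -polyC_natr mul_polyC.
    by rewrite (leq_trans (size_scale_leq _ _)) // size_polyXn /= ltn_ord.
  rewrite coef_sum (bigD1 (Ordinal iN)) //= big1 ?addr0 => [|j ji].
    by rewrite -polyC_natr coefCM coefXn eqxx mulr1.
  rewrite -polyC_natr coefCM coefXn; case: eqP => [e|_]; last by rewrite mulr0.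
  by case/eqP: ji; apply: val_inj; rewrite /= e.
have [u [v [e [d [v1 uE dE dv [uE' eE eE']]]]]] := outerplanar_series zN.
have e1 := outerplanar_graph_series zN v1 uE; rewrite -dv in e1.
have e2 := dyck_series zN dE uE' eE eE'.
have := congr1 (fun p : R => (p : {poly int})`_n) (etrans e1 (esym e2)).
by rewrite !coef // !natz => -[].
Qed.
End CountingInt.

(** * The bijection *)

Lemma eq_graph_code n e e' :
  (forall i j, i < j <= n -> e i j = e' i j) <-> graph_code n e = graph_code n e'.
Proof.
split=> [ee'|ee' i j ijn].
  apply/eq_in_map => j; rewrite mem_iota => jn; apply: eq_in_filter => i.
  by rewrite mem_rev mem_iota => ij; apply: ee'; lia.
have jn : j.-1 < size (iota 1 n) by rewrite size_iota; lia.
have := congr1 (fun L => i \in nth [::] L j.-1) ee'.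
rewrite !(nth_map 0) // nth_iota; last by lia.
rewrite (_ : 1 + j.-1 = j); last by lia.
by rewrite !mem_smaller; case/andP: ijn => ->.
Qed.

Section MapCode.
Local Open Scope quotient_scope.
Variable n : nat.

Definition map_code (M : labelled_outerplanar_map n.+1) :=
  graph_code n (map_adjacent (val M)).

(** A code records only pairs [i < j <= n]; symmetry, irreflexivity and the bound on ranks settle
    all the others. *)
Lemma map_code_iso M N : map_code M = map_code N <-> outerplanar_iso M N.
Proof.
have [M_ok N_ok] := (valP M, valP N); split=> [/eq_graph_code MN|MN]; last first.
  by apply/eq_graph_code => i j _; apply: iso_map_adjacent.
apply: (map_adjacent_iso M_ok N_ok) => i j; have [ij|ji|->] := ltngtP i j; last first.
- by rewrite (map_adjacent_irrefl M_ok) (map_adjacent_irrefl N_ok).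
- have [jn|jn] := leqP i n.
    by rewrite (map_adjacent_sym M_ok) (map_adjacent_sym N_ok) MN // ji.
  by apply/idP/idP => [/(map_adjacent_bound M_ok)|/(map_adjacent_bound N_ok)]; lia.
- have [jn|jn] := leqP j n; first by rewrite MN // ij.
  by apply/idP/idP => [/(map_adjacent_bound M_ok)|/(map_adjacent_bound N_ok)]; lia.
Qed.

Lemma mem_map_code M : map_code M \in codes n 1 [:: 0].
Proof. by apply/mem_graph_code; apply: (map_adjacent_canonical (valP M)). Qed.

Lemma map_code_surj L : 0 < n -> L \in codes n 1 [:: 0] -> exists M, map_code M = L.
Proof.
move=> n0 /codes_graph[e e_can <-]; have [M M_ok Me] := canonical_map n0 e_can.
by exists (Sub M M_ok); apply/eq_graph_code; rewrite SubK.
Qed.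

Definition outerplanar_code (q : outerplanar_map n.+1) := map_code (repr q).

Lemma outerplanar_code_inj : injective outerplanar_code.
Proof.
move=> p q /map_code_iso pq; rewrite -[p]reprK -[q]reprK; apply/eqmodP.
exact: pq.
Qed.

Lemma outerplanar_code_pi M : outerplanar_code (\pi M) = map_code M.
Proof.
apply/map_code_iso; have /eqmodP := reprK (\pi_(outerplanar_map n.+1) M); exact.
Qed.

(** The quotient is taken of an infinite type, so its finiteness is obtained by choosing one map for
    each code. *)
Lemma outerplanar_enumeration : 0 < n -> exists s : seq (outerplanar_map n.+1),
  [/\ uniq s, forall q, q \in s & size s = #|{: coloured_dyck_path n}|].
Proof.
move=> n0; have [s sE] : exists s, [seq outerplanar_code q | q <- s] = codes n 1 [:: 0].
  elim: (codes _ _ _) (fun L => @map_code_surj L n0) => [|L Ls IH] surj; first by exists [::].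
  have [s <-] : exists s, [seq outerplanar_code q | q <- s] = Ls.
    by apply: IH => L' LL'; apply: surj; rewrite inE LL' orbT.
  have [M <-] := surj L (mem_head _ _).
  by exists (\pi M :: s); rewrite /= outerplanar_code_pi.
exists s; split.
- by apply: (map_uniq (f := outerplanar_code)); rewrite sE codes_uniq.
- move=> q; have : outerplanar_code q \in codes n 1 [:: 0] by apply: mem_map_code.
  by rewrite -sE (mem_map outerplanar_code_inj).
- by rewrite card_coloured_dyck_path -graph_dyck_count -(@size_codes n 1 [:: 0]) // -sE size_map.
Qed.
End MapCode.

Theorem theorem5p1 (n : nat) (hn : 1 <= n) :
  (exists f : outerplanar_map n.+1 -> coloured_dyck_path n, bijective f) /\
  (exists s : seq (outerplanar_map n.+1),
     Finite.axiom s /\ size s = #|{: coloured_dyck_path n}|).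
Proof.
have [s [s_uniq s_all s_size]] := outerplanar_enumeration hn.
split; last by exists s; split=> // q; rewrite count_uniq_mem // s_all.
(* The bijection pairs elements with equal index in the two enumerations. *)
have idx q : index q s < #|{: coloured_dyck_path n}| by rewrite -s_size index_mem.
exists (fun q => enum_val (Ordinal (idx q))).
exists (fun c => tnth (in_tuple s) (cast_ord (esym s_size) (enum_rank c))) => [q|c].
  by rewrite enum_valK (tnth_nth q) /= nth_index.
apply: enum_rank_inj; rewrite enum_valK; apply: val_inj => /=.
set i := cast_ord _ _.
by rewrite (tnth_nth (tnth (in_tuple s) i)) index_uniq ?s_size //= s_size.
Qed.
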